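(* Let $n\ge 1$, $0<s<1$, let $\Omega\subset\mathbb{R}^n$ be a bounded open set with Lipschitz continuous boundary, and let $\beta\in L^1(\mathbb{R}^n\setminus\Omega)$ be non-negative. Then the semigroups $T_D$, $T_R$ and $T_N$ on $L^2(\Omega)$ associated with the forms $\mathfrak a_D$, $\mathfrak a_R$ and $\mathfrak a_N$, respectively, are submarkovian.
   Context: Functions are real-valued and identified when equal almost everywhere. $C_{n,s}:=\frac{s2^{2s}\Gamma(\frac{2s+n}{2})}{\pi^{n/2}\Gamma(1-s)}$. $W^{s,2}_{\beta,\Omega}$ is the space of all measurable $u:\mathbb{R}^n\to\mathbb{R}$ with $\int_\Omega|u|^2dx+\int_{\mathbb{R}^n\setminus\Omega}|u|^2|\beta|dx+\iint_{\mathbb{R}^{2n}\setminus(\mathbb{R}^n\setminus\Omega)^2}\frac{|u(x)-u(y)|^2}{|x-y|^{n+2s}}dxdy<\infty$; $W^{s,2}_\Omega:=W^{s,2}_{0,\Omega}$ (the case $\beta=0$). For $u,v\in W^{s,2}_{\Omega}$, $$\mathcal E(u,v):=\frac{C_{n,s}}{2}\int_\Omega\int_\Omega\frac{(u(x)-u(y))(v(x)-v(y))}{|x-y|^{n+2s}}dydx+C_{n,s}\int_\Omega\int_{\mathbb{R}^n\setminus\Omega}\frac{(u(x)-u(y))(v(x)-v(y))}{|x-y|^{n+2s}}dydx.$$ Extensions: let $\rho(x):=\int_\Omega\frac{dy}{|x-y|^{n+2s}}$ for $x\in\mathbb{R}^n\setminus\overline\Omega$. For $u\in L^2(\Omega)$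 let $u_D=u_N=u_R=u$ in $\Omega$, and $u_D=0$ in $\mathbb{R}^n\setminus\Omega$; for $x\in\mathbb{R}^n\setminus\overline\Omega$ let $u_N(x):=\frac1{\rho(x)}\int_\Omega\frac{u(y)}{|x-y|^{n+2s}}dy$ and $u_R(x):=\frac{C_{n,s}}{C_{n,s}\rho(x)+\beta(x)}\int_\Omega\frac{u(y)}{|x-y|^{n+2s}}dy$. Forms on $L^2(\Omega)$: $D(\mathfrak a_D)=\{u\in L^2(\Omega):u_D\in W^{s,2}_\Omega\}$, $\mathfrak a_D(u,v)=\mathcal E(u_D,v_D)$; $D(\mathfrak a_N)=\{u\in L^2(\Omega):u_N\in W^{s,2}_\Omega\}$, $\mathfrak a_N(u,v)=\mathcal E(u_N,v_N)$; $D(\mathfrak a_R)=\{u\in L^2(\Omega):u_R\in W^{s,2}_{\beta,\Omega}\}$, $\mathfrak a_R(u,v)=\mathcal E(u_R,v_R)+\int_{\mathbb{R}^n\setminus\Omega}\beta u_Rv_Rdx$. These are densely defined, symmetric, closed non-negative forms; for $\bullet\in\{D,N,R\}$, $A_\bullet$ is the non-negative selfadjoint operator with $D(A_\bullet)=\{u\in D(\mathfrak a_\bullet):\exists f\in L^2(\Omega)\ \mathfrak a_\bullet(u,v)=(f,v)_{L^2(\Omega)}\ \forall v\in D(\mathfrak a_\bullet)\}$, $A_\bullet u=f$, and $T_\bullet=(e^{-tA_\bullet})_{t\ge0}$. A semigroup $T=(T(t))_{t\ge0}$ on $L^2(\Omega)$ is positivity-preserving if $u\ge0$ implies $T(t)u\ge0$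 for all $t\ge0$; it is $L^\infty$-contractive if $\|T(t)u\|_{L^\infty(\Omega)}\le\|u\|_{L^\infty(\Omega)}$ for all $t\ge0$ and $u\in L^2(\Omega)\cap L^\infty(\Omega)$; it is submarkovian if it is both. *)

(* Defs.v *)
From HB Require Import structures.
From mathcomp Require Import all_boot all_order all_algebra.
From mathcomp Require Import all_classical all_reals all_analysis.

Set Implicit Arguments.
Unset Strict Implicit.
Unset Printing Implicit Defensive.
Import Order.TTheory GRing.Theory Num.Theory.
Import numFieldNormedType.Exports.
Local Open Scope classical_set_scope.
Local Open Scope ring_scope.

(** ** Borel sets and Lebesgue measure on R^n

    The sigma-algebra on ['rV[R]_n] is generated by the coordinates. *)

Section measurable_rV.
Context {R : realType} (n : nat).

Let coors : 'I_n -> 'rV[R]_n -> R := fun i x => x 0 i.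

Let rV_set0 : g_sigma_preimage coors set0.
Proof. exact: sigma_algebra0. Qed.

Let rV_setC A : g_sigma_preimage coors A -> g_sigma_preimage coors (~` A).
Proof. exact: sigma_algebraC. Qed.

Let rV_bigcup (F : _^nat) : (forall i, g_sigma_preimage coors (F i)) ->
  g_sigma_preimage coors (\bigcup_i (F i)).
Proof. exact: sigma_algebra_bigcup. Qed.

HB.instance Definition _ := @isMeasurable.Build default_measure_display
  'rV[R]_n (g_sigma_preimage coors) rV_set0 rV_setC rV_bigcup.

Lemma measurable_coord_rV (i : 'I_n) :
  measurable_fun [set: 'rV[R]_n] (fun x : 'rV[R]_n => x 0 i).
Proof.
move=> _ Y mY; rewrite setTI; apply: sub_sigma_algebra => /=.
rewrite -bigcup_seq/=; exists i => /=; first by rewrite mem_index_enum.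
by exists Y => //; rewrite setTI.
Qed.

Lemma measurable_fun_rVP d (T : measurableType d) (f : T -> 'rV[R]_n) :
  measurable_fun [set: T] f <->
  forall i, measurable_fun [set: T] (fun t => f t 0 i).
Proof.
split=> [mf i|mf].
  by apply: (measurableT_comp (measurable_coord_rV i)).
move=> _ A mA; rewrite setTI.
have : g_sigma_preimage (fun i => coors i \o f) (f @^-1` A).
  by rewrite g_sigma_preimage_comp; exists A => //; rewrite setTI.
move: {A mA} (_ @^-1` A); apply: smallest_sub.
  exact: sigma_algebra_measurable.
move=> B; rewrite -bigcup_seq => -[i _ [C mC <-]].
exact: mf.
Qed.

End measurable_rV.

Section lebesgue_step.
Context {R : realType} (n : nat).
Variable m : {sigma_finite_measure set 'rV[R]_n -> \bar R}.

Definition cons_rV (p : R * 'rV[R]_n) : 'rV[R]_n.+1 :=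
  \row_i if unlift ord0 i is Some j then p.2 0 j else p.1.

Definition uncons_rV (x : 'rV[R]_n.+1) : R * 'rV[R]_n :=
  (x 0 ord0, \row_i x 0 (lift ord0 i)).

Lemma cons_rVK : cancel cons_rV uncons_rV.
Proof.
case=> a v; rewrite /uncons_rV /cons_rV; congr pair.
  by rewrite mxE unlift_none.
by apply/rowP => i; rewrite !mxE liftK.
Qed.

Lemma measurable_cons_rV : measurable_fun [set: R * 'rV[R]_n] cons_rV.
Proof.
apply/measurable_fun_rVP => i.
under eq_fun do rewrite mxE.
case: unliftP => [j _|_]; last exact: measurable_fst.
exact: (measurableT_comp (measurable_coord_rV j) measurable_snd).
Qed.

Lemma measurable_uncons_rV : measurable_fun [set: 'rV[R]_n.+1] uncons_rV.
Proof.
apply/measurable_fun_pair => /=; first exact: measurable_coord_rV.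
apply/measurable_fun_rVP => i.
under eq_fun do rewrite mxE.
exact: measurable_coord_rV.
Qed.

Definition lebesgue_step : set 'rV[R]_n.+1 -> \bar R :=
  pushforward (lebesgue_measure \x m)%E cons_rV.

Let lebesgue_step0 : lebesgue_step set0 = 0%E.
Proof. by rewrite /lebesgue_step /pushforward preimage_set0 measure0. Qed.

Let lebesgue_step_ge0 A : (0 <= lebesgue_step A)%E.
Proof. exact: (@measure_ge0 _ _ _ (lebesgue_measure \x m)%E). Qed.

Let lebesgue_step_sigma_additive : semi_sigma_additive lebesgue_step.
Proof.
move=> F mF tF mUF; rewrite /lebesgue_step /pushforward preimage_bigcup.
apply: (@measure_semi_sigma_additive _ _ _ (lebesgue_measure \x m)%E).
- by move=> k; rewrite -[X in measurable X]setTI; exact: measurable_cons_rV.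
- apply/trivIsetP => /= i j _ _ ij; rewrite -preimage_setI.
  by move/trivIsetP : tF => /(_ _ _ _ _ ij) ->//; rewrite preimage_set0.
- by rewrite -preimage_bigcup -[X in measurable X]setTI; exact: measurable_cons_rV.
Qed.

HB.instance Definition _ := isMeasure.Build _ _ _ lebesgue_step
  lebesgue_step0 lebesgue_step_ge0 lebesgue_step_sigma_additive.

Let lebesgue_step_sigma_finite : sigma_finite setT lebesgue_step.
Proof.
have /sigma_finiteP[F [TF ndF Foo]] := sigma_finiteT (@lebesgue_measure R).
have /sigma_finiteP[G [TG ndG Goo]] := sigma_finiteT m.
exists (fun k => uncons_rV @^-1` (F k `*` G k)).
  rewrite -preimage_bigcup (_ : \bigcup_k _ = setT) ?preimage_setT//.
  rewrite -setXTT TF TG predeqE => -[x y]; split.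
    by move=> [k _ []/= ? ?]; split; exists k.
  move=> [/= [k _ Fkx] [l _ Gly]]; exists (maxn k l) => //; split.
  - by move: x Fkx; exact/subsetPset/ndF/leq_maxl.
  - by move: y Gly; exact/subsetPset/ndG/leq_maxr.
move=> k; have [mF Fk] := Foo k; have [mG Gk] := Goo k; split.
  rewrite -[X in measurable X]setTI; apply: measurable_uncons_rV => //.
  exact: measurableX.
rewrite /lebesgue_step /pushforward -comp_preimage.
rewrite (_ : uncons_rV \o cons_rV = id); last exact/funext/cons_rVK.
by rewrite preimage_id product_measure1E// lte_mul_pinfty// ge0_fin_numE.
Qed.

HB.instance Definition _ := Measure_isSigmaFinite.Build _ _ _ lebesgue_step
  lebesgue_step_sigma_finite.

End lebesgue_step.

Fixpoint lebesgue {R : realType} (n : nat) :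
    {sigma_finite_measure set 'rV[R]_n -> \bar R} :=
  if n is k.+1 then lebesgue_step (lebesgue k) else \d_(0 : 'rV[R]_0).

Lemma measurable_box {R : realType} (n : nat) (a b : 'I_n -> R) :
  measurable [set x : 'rV[R]_n | forall i, x 0 i \in `]a i, b i]].
Proof.
rewrite (_ : mkset _ = \bigcap_(i in [set: 'I_n])
    ((fun x : 'rV[R]_n => x 0 i) @^-1` [set y | y \in `]a i, b i]])).
  apply: fin_bigcap_measurable; [exact: finite_finset|] => i _.
  rewrite -[X in measurable X]setTI.
  exact: (measurable_coord_rV i measurableT (measurable_itv _)).
by apply/seteqP; split => x /= h i *; [exact: h|exact: (h i I)].
Qed.

Lemma lebesgue_box {R : realType} (n : nat) (a b : 'I_n -> R) :
  (forall i, a i <= b i) ->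
  lebesgue n [set x : 'rV[R]_n | forall i, x 0 i \in `]a i, b i]] =
  (\prod_(i < n) (b i - a i))%:E.
Proof.
elim: n a b => [|n IH] a b ab.
  by rewrite big_ord0 /= diracE mem_set//; case.
rewrite /= /lebesgue_step /pushforward.
rewrite (_ : _ @^-1` _ = [set y | y \in `]a ord0, b ord0]] `*`
    [set x : 'rV[R]_n |
      forall i, x 0 i \in `]a (lift ord0 i), b (lift ord0 i)]]).
  rewrite product_measure1E//=; last exact: measurable_box.
  rewrite (IH (fun i => a (lift ord0 i)) (fun i => b (lift ord0 i)))//.
  rewrite lebesgue_measure_itv/= big_ord_recl EFinM lte_fin.
  congr (_ * _)%E; case: ltP => // h.
  by rewrite (le_anti (_ : a ord0 <= b ord0 <= a ord0)) ?subrr// ab.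
apply/seteqP; split => [[x y]|[x y]] /=.
  move=> h; split; first by have := h ord0; rewrite /cons_rV mxE unlift_none.
  by move=> i; have := h (lift ord0 i); rewrite /cons_rV mxE liftK.
by move=> [h1 h2] i; rewrite /cons_rV mxE; case: unliftP => [j ->|->].
Qed.

(** ** The operator-theoretic notions on L^2(Omega)

    A function [u : 'rV[R]_n -> R] represents the element [u|_Omega] of
    L^p(Omega): its values outside [Omega] are irrelevant, and two functions
    represent the same element when they agree a.e. in [Omega].  Membership and
    norms are those of the extension by zero [u \_ Omega] in L^p(R^n). *)

Section L2.
Context {R : realType} {n : nat}.
Local Notation X := 'rV[R]_n.
Local Notation mu := (lebesgue n).
Implicit Types (Omega : set X) (p : \bar R) (u v f g : X -> R) (t : R).

Definition Lp Omega p u : Prop := u \_ Omega \in Lfun mu p.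

Definition Lpnorm Omega p u : \bar R := 'N[mu]_p[EFin \o (u \_ Omega)].

Definition L2inner Omega u v : R := \int[mu]_(x in Omega) (u x * v x).

(** [T t u] is only meaningful for [0 <= t] and [Lp Omega 2 u]. *)
Record C0_semigroup Omega (T : R -> (X -> R) -> X -> R) : Prop := {
  semigroup_L2 : forall t u, 0 <= t -> Lp Omega 2 u -> Lp Omega 2 (T t u) ;
  semigroup_ae : forall t u v, 0 <= t -> Lp Omega 2 u -> Lp Omega 2 v ->
    u = v %[ae mu in Omega] -> T t u = T t v %[ae mu in Omega] ;
  semigroup_linear : forall t (a : R) u v, 0 <= t ->
    Lp Omega 2 u -> Lp Omega 2 v ->
    T t (fun x => a * u x + v x) = (fun x => a * T t u x + T t v x)
      %[ae mu in Omega] ;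
  semigroup_bounded : forall t, 0 <= t -> exists M : R,
    forall u, Lp Omega 2 u ->
      (Lpnorm Omega 2 (T t u) <= M%:E * Lpnorm Omega 2 u)%E ;
  semigroup0 : forall u, Lp Omega 2 u -> T 0 u = u %[ae mu in Omega] ;
  semigroupD : forall t r u, 0 <= t -> 0 <= r -> Lp Omega 2 u ->
    T (t + r) u = T t (T r u) %[ae mu in Omega] ;
  semigroup_continuous : forall t u, 0 <= t -> Lp Omega 2 u ->
    Lpnorm Omega 2 (fun x => T r u x - T t u x)
      @[r --> within [set r | 0 <= r] (nbhs t)] --> 0%E }.

(** [generator Omega T u g]: [u] is in the domain of the infinitesimal generator
    of [T], which maps it to [g]. *)
Definition generator Omega (T : R -> (X -> R) -> X -> R) u g : Prop :=
  [/\ Lp Omega 2 u, Lp Omega 2 g &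
    Lpnorm Omega 2 (fun x => h^-1 * (T h u x - u x) - g x)
      @[h --> 0^'+] --> 0%E].

(** [form_operator Omega D a u f]: [u] is in the domain of the operator
    associated with the form [a] on [D], which maps it to [f]. *)
Definition form_operator Omega (D : set (X -> R))
    (a : (X -> R) -> (X -> R) -> R) u f : Prop :=
  [/\ D u, Lp Omega 2 f & forall v, D v -> a u v = L2inner Omega f v].

(** [T = (exp (- t A))_t] where [A] is the operator associated with [a], i.e.
    [T] is the strongly continuous semigroup whose generator is [- A]. *)
Definition form_semigroup Omega (D : set (X -> R))
    (a : (X -> R) -> (X -> R) -> R) (T : R -> (X -> R) -> X -> R) : Prop :=
  C0_semigroup Omega T /\
  forall u g, generator Omega T u g <->
              form_operator Omega D a u (fun x => - g x).

Definition positivity_preserving Omega (T : R -> (X -> R) -> X -> R) : Prop :=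
  forall t u, 0 <= t -> Lp Omega 2 u ->
    (\forall x \ae mu, Omega x -> 0 <= u x) ->
    (\forall x \ae mu, Omega x -> 0 <= T t u x).

Definition Linfty_contractive Omega (T : R -> (X -> R) -> X -> R) : Prop :=
  forall t u, 0 <= t -> Lp Omega 2 u -> Lp Omega +oo%E u ->
    (Lpnorm Omega +oo (T t u) <= Lpnorm Omega +oo u)%E.

Definition submarkovian Omega (T : R -> (X -> R) -> X -> R) : Prop :=
  positivity_preserving Omega T /\ Linfty_contractive Omega T.

End L2.

(** ** Lipschitz domains

    Near each boundary point and in suitable orthogonal coordinates [x *m Q],
    [Omega] is the strict epigraph of a Lipschitz function of the coordinates
    other than the [k]-th. *)

Definition lipschitz_boundary {R : realType} {n : nat} (Omega : set 'rV[R]_n) :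
    Prop :=
  forall z, (closure Omega `\` interior Omega) z ->
  exists (Q : 'M[R]_n) (k : 'I_n) (g : 'rV[R]_n.-1 -> R),
    [/\ Q *m Q^T = 1%:M, [lipschitz g y | y in setT] &
        \forall x \near z, Omega x <-> g (col' k (x *m Q)) < (x *m Q) 0 k].

(** ** The nonlocal forms *)

Definition Gamma {R : realType} (z : R) : R :=
  \int[lebesgue_measure]_(t in `]0, +oo[) (t `^ (z - 1) * expR (- t)).

Section forms.
Context {R : realType} {n : nat}.
Local Notation X := 'rV[R]_n.
Local Notation mu := (lebesgue n).
Variables (s : R) (Omega : set X) (beta : X -> R).
Implicit Types (b u v : X -> R) (x y : X).

(** The norm [`|x|] of the library on ['rV[R]_n] is the sup norm. *)
Definition enorm x : R := Num.sqrt (\sum_(i < n) x 0 i ^+ 2).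

Definition sing_kernel x y : R := (enorm (x - y) `^ (n%:R + 2 * s))^-1.

Definition Cns : R :=
  s * 2 `^ (2 * s) * Gamma ((2 * s + n%:R) / 2) /
  (pi `^ (n%:R / 2) * Gamma (1 - s)).

Definition W b u : Prop :=
  measurable_fun setT u /\
  (\int[mu]_(x in Omega) (`|u x| ^+ 2)%:E +
   \int[mu]_(x in ~` Omega) (`|u x| ^+ 2 * `|b x|)%:E +
   \int[mu \x mu]_(z in ~` (~` Omega `*` ~` Omega))
     (`|u z.1 - u z.2| ^+ 2 * sing_kernel z.1 z.2)%:E < +oo)%E.

Definition energy u v : R :=
  Cns / 2 * (\int[mu]_(x in Omega) \int[mu]_(y in Omega)
    ((u x - u y) * (v x - v y) * sing_kernel x y)) +
  Cns * (\int[mu]_(x in Omega) \int[mu]_(y in ~` Omega)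
    ((u x - u y) * (v x - v y) * sing_kernel x y)).

Definition rho x : R := \int[mu]_(y in Omega) sing_kernel x y.

(** The extensions are given the value [0] on the boundary of [Omega], a null
    set when the boundary is Lipschitz. *)
Definition ext_D u x : R := if x \in Omega then u x else 0.

Definition ext_N u x : R :=
  if x \in Omega then u x else
  if x \in closure Omega then 0 else
  1 / rho x * \int[mu]_(y in Omega) (u y * sing_kernel x y).

Definition ext_R u x : R :=
  if x \in Omega then u x else
  if x \in closure Omega then 0 else
  Cns / (Cns * rho x + beta x) * \int[mu]_(y in Omega) (u y * sing_kernel x y).

Definition dom_D : set (X -> R) :=
  [set u | Lp Omega 2 u /\ W (fun=> 0) (ext_D u)].

Definition form_D u v : R := energy (ext_D u) (ext_D v).

Definition dom_N : set (X -> R) :=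
  [set u | Lp Omega 2 u /\ W (fun=> 0) (ext_N u)].

Definition form_N u v : R := energy (ext_N u) (ext_N v).

Definition dom_R : set (X -> R) :=
  [set u | Lp Omega 2 u /\ W beta (ext_R u)].

Definition form_R u v : R :=
  energy (ext_R u) (ext_R v) +
  \int[mu]_(x in ~` Omega) (beta x * ext_R u x * ext_R v x).

End forms.

(* Main.v *)
(** Put [P u = (u - c)^+] with [c >= 0].  For each of the three forms, [u] in the
    domain implies that [P u] is in the domain and [a(u, P u) >= 0].  Outside
    [Omega] the extension [U] of [u] is zero or, up to a penalty [b U^2], the
    weighted mean of [u] for the weight [K(x, .)]; the mean of [P u] minimizes a
    quadratic functional, so the extension of [P u] has no more energy than [P U].

    Along an orbit [w = T u] starting in the domain of the generator, the right
    derivative of [|P w|^2 / 2] is [(P w, w') = - a(w, P w) <= 0], hence [|P w|]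
    is nonincreasing; by density of this domain in L^2 (time averages of orbits)
    the same holds for every [u] in L^2.  Thus [u <= c] is preserved for every
    [c >= 0]: [c = 0] applied to [- u] gives positivity, and [c = |u|_oo] applied
    to [u] and [- u] gives contractivity in L^oo. *)

Require Import Defs.
From mathcomp Require Import all_boot all_order all_algebra.
From mathcomp Require Import all_classical all_reals all_analysis.
From mathcomp Require Import measurable_realfun ess_sup_inf.
From mathcomp Require Import ring lra.

Set Implicit Arguments.
Unset Strict Implicit.
Unset Printing Implicit Defensive.
Import Order.TTheory GRing.Theory Num.Theory.
Import numFieldNormedType.Exports.
Local Open Scope classical_set_scope.
Local Open Scope ring_scope.

(** * Density of the domain of the generator in a complete seminormed space *)

(** The obstacle is that extension and truncation do not commute: outside [Omega] the extension [V]
    of [P u] differs from [P U], so the usual pointwise contraction inequalities hold only inside.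
    At a fixed exterior point x they are replaced by two inequalities for integrals over y in
    [Omega], both resting on the balance equation (rho + b) U = int u K(x, .). To treat the three
    boundary conditions at once, each extension is written as a multiplier times the kernel
    integral. Since [Cns] multiplies the energy but not the Robin term, the penalty weight becomes b
    = beta / [Cns].

    The semigroup is linked to the form only through its generator, a limit as h tends to 0 from the
    right; hence the one-sided slopes in the decay argument. Time averages are limits of dyadic
    means in a complete seminormed space, so no integral of vector-valued functions is involved, and
    identities are read modulo vectors of seminorm 0 because functions represent classes. *)

Section seminormed_semigroup.
Context {R : realType} {E : lmodType R}.
Variable N : E -> R.
Hypothesis seminormD : forall u v, N (u + v) <= N u + N v.
Hypothesis seminormZ : forall a u, N (a *: u) = `|a| * N u.
Implicit Types (u v w : E) (a c t r h d e : R).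

Lemma seminorm0 : N 0 = 0.
Proof. by rewrite -(scale0r 0) seminormZ normr0 mul0r. Qed.

Lemma seminormN u : N (- u) = N u.
Proof. by rewrite -scaleN1r seminormZ normrN1 mul1r. Qed.

Lemma seminorm_ge0 u : 0 <= N u.
Proof.
have := seminormD u (- u).
by rewrite subrr seminorm0 seminormN -mulr2n pmulrn_lge0.
Qed.

Lemma seminorm_distC u v : N (u - v) = N (v - u).
Proof. by rewrite -seminormN opprB. Qed.

Lemma seminorm_dist v u w : N (u - w) <= N (u - v) + N (v - w).
Proof. by rewrite -[u - w](subrKA v) seminormD. Qed.

(** Equality in the quotient by null vectors. The semigroup laws hold only in this sense, so it
    replaces equality in the whole section. *)
Let eqv u v := N (u - v) = 0.

Let eqv_le u v : N (u - v) <= 0 -> eqv u v.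
Proof. by move=> h; apply/eqP; rewrite eq_le h seminorm_ge0. Qed.

Let eqvxx u : eqv u u.
Proof. by rewrite /eqv subrr seminorm0. Qed.

Let eqvC u v : eqv u v -> eqv v u.
Proof. by rewrite /eqv seminorm_distC. Qed.

Let eqv_trans v u w : eqv u v -> eqv v w -> eqv u w.
Proof.
by move=> uv vw; apply: eqv_le; rewrite (le_trans (seminorm_dist v _ _))// uv vw addr0.
Qed.

Let eqvD u v u' v' : eqv u v -> eqv u' v' -> eqv (u + u') (v + v').
Proof.
move=> uv uv'; apply: eqv_le; rewrite opprD addrACA.
by rewrite (le_trans (seminormD _ _))// uv uv' addr0.
Qed.

Let eqvZ a u v : eqv u v -> eqv (a *: u) (a *: v).
Proof. by rewrite /eqv -scalerBr seminormZ => ->; rewrite mulr0. Qed.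

Let eqvN u v : eqv u v -> eqv (- u) (- v).
Proof. by move/(eqvZ (-1)); rewrite !scaleN1r. Qed.

Let eqvN_le u v e : eqv u v -> N u <= e -> N v <= e.
Proof.
move=> uv ue; rewrite -[v](subrK u) (le_trans (seminormD _ _))//.
by rewrite seminorm_distC uv add0r.
Qed.

Definition seminorm_cvg (f : nat -> E) v :=
  forall e, 0 < e -> exists k, forall i, (k <= i)%N -> N (f i - v) <= e.

Lemma seminorm_cvg_le f v y e : seminorm_cvg f v ->
  (exists k, forall i, (k <= i)%N -> N (f i - y) <= e) -> N (v - y) <= e.
Proof.
move=> fv [k fy]; apply/ler_addgt0Pr => d d0.
have [j {}fv] := fv _ d0.
rewrite (le_trans (seminorm_dist (f (maxn k j)) _ _))// addrC lerD//.
  by apply: fy; rewrite leq_maxl.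
by rewrite seminorm_distC; apply: fv; rewrite leq_maxr.
Qed.

Lemma seminorm_cvgD f g u v : seminorm_cvg f u -> seminorm_cvg g v ->
  seminorm_cvg (fun i => f i + g i) (u + v).
Proof.
move=> fu gv e e0; have e20 : 0 < e / 2 by rewrite divr_gt0.
have [k fk] := fu _ e20; have [j gj] := gv _ e20.
exists (maxn k j) => i; rewrite geq_max => /andP[ki ji].
rewrite opprD addrACA (le_trans (seminormD _ _))// [leRHS]splitr.
by rewrite lerD// ?fk ?gj.
Qed.

Lemma seminorm_cvgZ f u a : seminorm_cvg f u ->
  seminorm_cvg (fun i => a *: f i) (a *: u).
Proof.
move=> fu e e0; have a0 : 0 < `|a| + 1 by rewrite ltr_wpDl.
have [k fk] := fu _ (divr_gt0 e0 a0).
exists k => i ki; rewrite -scalerBr seminormZ.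
rewrite (@le_trans _ _ ((`|a| + 1) * N (f i - u)))//.
  by rewrite ler_wpM2r ?seminorm_ge0// lerDl.
by rewrite mulrC -ler_pdivlMr// fk.
Qed.

Hypothesis complete : forall f : nat -> E,
  (forall e, 0 < e -> exists k, forall i, (k <= i)%N -> N (f i - f k) <= e) ->
  exists v, seminorm_cvg f v.

(* A Riemann sum, with 2 ^ k nodes, of the mean of [F] over [a, a + h]; halving
   the interval makes refinement and translation plain inductions on [k]. *)
Fixpoint dyadic_mean (F : R -> E) k a h :=
  if k is j.+1 then
    2^-1 *: (dyadic_mean F j a (h / 2) + dyadic_mean F j (a + h / 2) (h / 2))
  else F a.

Lemma seminorm_half_le (u v : E) e : N u <= e -> N v <= e ->
  N (2^-1 *: (u + v)) <= e.
Proof.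
move=> ue ve; rewrite seminormZ ger0_norm ?invr_ge0//.
rewrite mulrC ler_pdivrMr// mulr_natr mulr2n.
by rewrite (le_trans (seminormD _ _))// lerD.
Qed.

(** Balls are convex, and all nodes lie in [a, a + h]. *)
Lemma dyadic_mean_dist F k a h y e : 0 <= h ->
  (forall r, a <= r <= a + h -> N (F r - y) <= e) ->
  N (dyadic_mean F k a h - y) <= e.
Proof.
elim: k a h => [|k IH] a h h0 Fy /=.
  by apply: Fy; rewrite lexx lerDl.
have h2 : 0 <= h / 2 by rewrite divr_ge0.
have -> : forall u v, 2^-1 *: (u + v) - y = 2^-1 *: ((u - y) + (v - y)).
  move=> u v; rewrite addrACA -opprD scalerBr; congr (_ - _).
  by rewrite -mulr2n -[y *+ 2]scaler_nat scalerA mulVf ?scale1r ?pnatr_eq0.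
apply: seminorm_half_le; apply: IH => // r /andP[r1 r2]; apply: Fy.
  by rewrite r1 (le_trans r2)// lerD2l ler_pdivrMr// ler_peMr// ler1n.
rewrite (le_trans _ r1) ?lerDl//=; apply: (le_trans r2).
by rewrite -addrA -splitr.
Qed.

(** On each of the 2^k cells the coarse mean takes a single value and the fine one averages values
    at points of the same cell, of length h / 2^k. *)
Lemma dyadic_mean_refine F k m a h e : 0 <= h ->
  (forall r r', a <= r <= a + h -> a <= r' <= a + h ->
    `|r - r'| <= h / 2 ^+ k -> N (F r - F r') <= e) ->
  N (dyadic_mean F (k + m) a h - dyadic_mean F k a h) <= e.
Proof.
elim: k a h => [|k IH] a h h0 Fe.
  apply: dyadic_mean_dist => // r /andP[r1 r2]; apply: Fe; rewrite ?r1 ?r2//.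
    by rewrite lexx lerDl.
  by rewrite expr0 divr1 ger0_norm ?subr_ge0// lerBlDl.
have h2 : 0 <= h / 2 by rewrite divr_ge0.
have hh : h / 2 <= h by rewrite ler_pdivrMr// ler_peMr// ler1n.
rewrite /= -scalerBr opprD addrACA.
apply: seminorm_half_le; apply: IH => // r r' /andP[r1 r2] /andP[r'1 r'2] rr';
  apply: Fe; rewrite ?exprS ?invfM ?mulrA//.
- by rewrite r1 (le_trans r2)// lerD2l.
- by rewrite r'1 (le_trans r'2)// lerD2l.
- by rewrite (le_trans _ r1) ?lerDl//= (le_trans r2)// -addrA -splitr.
- by rewrite (le_trans _ r'1) ?lerDl//= (le_trans r'2)// -addrA -splitr.
Qed.

Variable T : R -> E -> E.
Hypothesis T_lin : forall t a u v, 0 <= t ->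
  N (T t (a *: u + v) - (a *: T t u + T t v)) = 0.
Hypothesis T_bnd : forall t, 0 <= t -> exists M, forall u, N (T t u) <= M * N u.
Hypothesis T_add : forall t r u, 0 <= t -> 0 <= r ->
  N (T (t + r) u - T t (T r u)) = 0.
Hypothesis T_cont : forall u t e, 0 <= t -> 0 < e -> exists2 d : R, 0 < d &
  forall r, 0 <= r -> `|r - t| < d -> N (T r u - T t u) <= e.

Let T_eqvB t u v : 0 <= t -> eqv (T t (u - v)) (T t u - T t v).
Proof.
move=> t0; have := T_lin (-1) v u t0.
by rewrite !scaleN1r [- v + u]addrC [- T t v + _]addrC.
Qed.

Let T_eqvD t u v : 0 <= t -> eqv (T t (u + v)) (T t u + T t v).
Proof. by move=> t0; have := T_lin 1 u v t0; rewrite !scale1r. Qed.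

Let T_eqvZ t a u : 0 <= t -> eqv (T t (a *: u)) (a *: T t u).
Proof.
move=> t0; have := T_lin a u 0 t0; rewrite addr0 => h.
apply: (eqv_trans h); rewrite -[X in eqv _ X]addr0; apply: eqvD => //.
have := T_eqvB 0 0 t0; rewrite !subrr; exact.
Qed.

Lemma semigroup_dyadic_mean u k t a h : 0 <= t -> 0 <= a -> 0 <= h ->
  eqv (T t (dyadic_mean (T ^~ u) k a h)) (dyadic_mean (T ^~ u) k (t + a) h).
Proof.
move=> t0; elim: k a h => [|k IH] a h a0 h0 /=.
  by apply: eqvC; apply: T_add.
have h2 : 0 <= h / 2 by rewrite divr_ge0.
apply: (eqv_trans (T_eqvZ _ _ t0)); apply: eqvZ.
apply: (eqv_trans (T_eqvD _ _ t0)); apply: eqvD; first exact: IH.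
by rewrite -addrA; apply: IH; rewrite ?addr_ge0.
Qed.

(** Heine's theorem on [0, a] from the covering form of compactness: the estimate holds for r near
    each point and all moduli d near 0 on the right, and compactness gives one d for all r. *)
Lemma semigroup_unif_continuous u a e : 0 < e -> exists2 d : R, 0 < d &
  forall r r', 0 <= r <= a -> 0 <= r' <= a -> `|r - r'| <= d ->
    N (T r u - T r' u) <= e.
Proof.
move=> e0; have e2 : 0 < e / 2 by rewrite divr_gt0.
have /compact_near_coveringP := @segment_compact R 0 a.
move=> /(_ _ (0^'+ : set_system R) (fun d r => 0 <= r ->
  forall r', 0 <= r' -> `|r - r'| <= d -> N (T r u - T r' u) <= e) _).
case.
  move=> r; rewrite /= in_itv/= => /andP[r0 ra].
  have [d d0 Td] := T_cont u r0 e2.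
  have d2 : 0 < d / 2 by rewrite divr_gt0.
  exists ([set x | `|x - r| < d / 2], [set i | i < d / 2]) => /=.
    split.
      by exists (d / 2) => //= x /=; rewrite distrC.
    exact: nbhs_right_lt.
  move=> [x i]/= [xr id] x0 r' r'0 xr'.
  rewrite (le_trans (seminorm_dist (T r u) _ _))// [leRHS]splitr lerD//.
    by apply: Td => //; rewrite (lt_trans xr)// ltr_pdivrMr// ltr_pMr// ltr1n.
  rewrite seminorm_distC; apply: Td => //.
  rewrite -[r' - r](subrKA x) [ltRHS]splitr (le_lt_trans (ler_normD _ _))//.
  by rewrite ltrD// distrC (le_lt_trans xr').
move=> d/= d0 dT; exists (d / 2); first by rewrite divr_gt0.
move=> r r' /andP[r0 ra] /andP[r'0 _] rr'.
apply: (dT (d / 2)) rr' => //; rewrite ?divr_gt0//.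
- by rewrite /= sub0r normrN gtr0_norm ?divr_gt0// ltr_pdivrMr// ltr_pMr// ltr1n.
- by rewrite /= in_itv/= r0.
Qed.

Lemma semigroup_mean_cvg u a h : 0 <= a -> 0 <= h ->
  exists v, seminorm_cvg (fun k => dyadic_mean (T ^~ u) k a h) v.
Proof.
move=> a0 h0; apply: complete => e e0.
have [d d0 Td] := semigroup_unif_continuous u (a + h) e0.
(* This index is large enough because k < 2^k, so that h / 2^k is below d. *)
exists (Num.truncn (h / d)).+1 => i ki.
rewrite -(subnK ki) addnC; apply: dyadic_mean_refine => // r r' /andP[r1 r2] /andP[r'1 r'2] rr'.
apply: Td; rewrite ?r2 ?r'2 ?(le_trans a0)//.
rewrite (le_trans rr')// ler_pdivrMr ?exprn_gt0// mulrC -ler_pdivrMr//.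
rewrite ltW// (lt_trans (truncnS_gt _))// -natrX ltr_nat.
exact: ltn_expl.
Qed.

Let mean_ex u : exists v : R -> R -> E, forall a h, 0 <= a -> 0 <= h ->
  seminorm_cvg (fun k => dyadic_mean (T ^~ u) k a h) (v a h).
Proof.
suff /choice[v Pv] : forall ah : R * R, exists v, 0 <= ah.1 -> 0 <= ah.2 ->
    seminorm_cvg (fun k => dyadic_mean (T ^~ u) k ah.1 ah.2) v.
  by exists (fun a h => v (a, h)) => a h; exact: (Pv (a, h)).
move=> [a h]/=; have [a0|a0] := boolP (0 <= a); last by exists 0.
have [h0|h0] := boolP (0 <= h); last by exists 0.
by have [v] := semigroup_mean_cvg u a0 h0; exists v.
Qed.

Let cvg_eqv f g u v : (forall i, eqv (f i) (g i)) ->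
  seminorm_cvg f u -> seminorm_cvg g v -> eqv u v.
Proof.
move=> fg fu gv; apply: eqv_le; apply/ler_addgt0Pr => e e0; rewrite add0r.
apply: (seminorm_cvg_le fu); have [k gk] := gv _ e0.
exists k => i ki; apply: eqvN_le (gk _ ki).
by apply: eqvD => //; exact: eqvC.
Qed.

Section mean.
Variables (u : E) (v : R -> R -> E).
Hypothesis vP : forall a h, 0 <= a -> 0 <= h ->
  seminorm_cvg (fun k => dyadic_mean (T ^~ u) k a h) (v a h).

Let mean_dist a h y e : 0 <= a -> 0 <= h ->
  (forall r, a <= r <= a + h -> N (T r u - y) <= e) -> N (v a h - y) <= e.
Proof.
move=> a0 h0 Fy; apply: (seminorm_cvg_le (vP a0 h0)).
by exists 0 => i _; exact: dyadic_mean_dist.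
Qed.

Let mean_half a h : 0 <= a -> 0 <= h ->
  eqv (v a h) (2^-1 *: (v a (h / 2) + v (a + h / 2) (h / 2))).
Proof.
move=> a0 h0; have h2 : 0 <= h / 2 by rewrite divr_ge0.
have ah2 : 0 <= a + h / 2 by rewrite addr_ge0.
apply: (@cvg_eqv (fun k => dyadic_mean (T ^~ u) k.+1 a h)
  (fun k => dyadic_mean (T ^~ u) k.+1 a h)) => //.
  move=> e /(vP a0 h0)[k kP]; exists k => i ki; apply: kP.
  by rewrite (leq_trans ki).
by apply: seminorm_cvgZ; apply: seminorm_cvgD; exact: vP.
Qed.

Let mean_shift t a h : 0 <= t -> 0 <= a -> 0 <= h ->
  eqv (T t (v a h)) (v (t + a) h).
Proof.
move=> t0 a0 h0; have [M TM] := T_bnd t0.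
have M0 : 0 < `|M| + 1 by rewrite ltr_wpDl.
apply: (@cvg_eqv (fun k => T t (dyadic_mean (T ^~ u) k a h))
  (fun k => dyadic_mean (T ^~ u) k (t + a) h)).
- by move=> k; exact: semigroup_dyadic_mean.
- move=> e e0; have [k kP] := vP a0 h0 (divr_gt0 e0 M0).
  exists k => i /kP ki; apply: (eqvN_le (T_eqvB _ _ t0)).
  rewrite (le_trans (TM _))//.
  rewrite (@le_trans _ _ ((`|M| + 1) * N (dyadic_mean (T^~ u) i a h - v a h)))//.
    by rewrite ler_wpM2r ?seminorm_ge0// (le_trans (ler_norm _))// lerDl.
  by rewrite mulrC -ler_pdivlMr.
- by apply: vP; rewrite ?addr_ge0.
Qed.

(* The mean over [a, a + h] differs from its translate by one dyadic step only
   through the first and the last of the small intervals. *)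
Let mean_telescope M a h : 0 <= a -> 0 <= h ->
  eqv (v (a + h / 2 ^+ M) h - v a h)
      ((2 ^+ M)^-1 *: (v (a + h) (h / 2 ^+ M) - v a (h / 2 ^+ M))).
Proof.
elim: M a h => [|M IH] a h a0 h0.
  by rewrite expr0 invr1 mulr1 scale1r.
have h2 : 0 <= h / 2 by rewrite divr_ge0.
rewrite exprS invfM mulrA; set k := h / 2 / 2 ^+ M.
have k0 : 0 <= k by rewrite divr_ge0// exprn_ge0.
have ak : 0 <= a + k by rewrite addr_ge0.
(* Halving gives the telescoped differences of the two halves; the short mean starting at a + h / 2
   occurs in both with opposite signs. *)
apply: (eqv_trans (eqvD (mean_half ak h0) (eqvN (mean_half a0 h0)))).
rewrite -scalerBr opprD addrACA -scalerA; apply: eqvZ.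
have ah2 : 0 <= a + h / 2 by rewrite addr_ge0.
have e1 := IH _ _ a0 h2; have e2 := IH _ _ ah2 h2.
rewrite -/k in e1 e2; rewrite [a + k + _]addrAC.
apply: (eqv_trans (eqvD e1 e2)).
by rewrite -scalerDr -[a + _ + _]addrA -splitr [X in eqv (_ *: X) _]addrC subrKA.
Qed.

(** Discrete form of the derivative of a moving average. Each of the m steps changes the mean by
    2^-M times a difference of two short means, which approximate [T h u] and [y] within e each;
    hence the error 2 e per step. *)
Let mean_increment M m h e y B : 0 < h -> m%:R * (h / 2 ^+ M) <= B ->
  (forall r, 0 <= r <= B -> N (T (r + h) u - T h u) <= e) ->
  (forall r, 0 <= r <= B -> N (T r u - y) <= e) ->
  N (v (m%:R * (h / 2 ^+ M)) h - v 0 h - (m%:R / 2 ^+ M) *: (T h u - y)) <=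
    (m%:R / 2 ^+ M) * (2 * e).
Proof.
move=> h0 + Th Ty; set k := h / 2 ^+ M.
have k0 : 0 < k by rewrite divr_gt0// exprn_gt0.
elim: m => [|m IH] mB.
  by rewrite !mul0r scale0r subrr subr0 seminorm0.
have mB' : m%:R * k <= B by rewrite (le_trans _ mB)// ler_pM2r// ler_nat.
have mk0 : 0 <= m%:R * k by rewrite mulr_ge0// ltW.
have := mean_telescope M mk0 (ltW h0); rewrite -/k.
rewrite -natr1 mulrDl mul1r in mB *; move=> tel.
have -> : v (m%:R * k + k) h - v 0 h - ((m%:R + 1) / 2 ^+ M) *: (T h u - y) =
    (v (m%:R * k) h - v 0 h - (m%:R / 2 ^+ M) *: (T h u - y)) +
    ((v (m%:R * k + k) h - v (m%:R * k) h) - (2 ^+ M)^-1 *: (T h u - y)).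
  rewrite mulrDl mul1r scalerDl opprD; apply/eqP.
  rewrite [X in _ == X]addrACA [in X in _ == X](addrC (v (m%:R * k) h - _)).
  by rewrite subrKA.
rewrite (le_trans (seminormD _ _))// mulrDl [leRHS]mulrDl lerD// ?IH//.
apply: (@eqvN_le ((2 ^+ M)^-1 *: ((v (m%:R * k + h) k - v (m%:R * k) k) - (T h u - y)))).
  by rewrite scalerBr; apply: eqvD => //; exact: eqvC.
rewrite seminormZ ger0_norm ?invr_ge0 ?exprn_ge0// mul1r ler_pM2l ?invr_gt0 ?exprn_gt0//.
rewrite opprB [y - _]addrC addrACA [- v _ _ + y]addrC.
rewrite [2 * e]mulr_natl [e *+ 2]mulr2n (le_trans (seminormD _ _))//.
rewrite lerD//; last first.
  rewrite seminorm_distC; apply: mean_dist => //; first exact: ltW.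
  by move=> r /andP[r1 r2]; apply: Ty; rewrite (le_trans mk0)// (le_trans r2).
apply: mean_dist; [by rewrite addr_ge0// ltW|exact: ltW|].
move=> r /andP[r1 r2]; rewrite -(subrK h r); apply: Th; apply/andP; split.
  by rewrite subr_ge0 (le_trans _ r1)// lerDr.
by rewrite lerBlDr (le_trans r2)// addrAC lerD2r.
Qed.

(* Increments by multiples of a dyadic step telescope; all other increments are
   reached by continuity of [t |-> T t (v 0 h)]. *)
Lemma mean_generator h y : 0 < h -> eqv (T 0 u) y -> forall e, 0 < e ->
  exists2 d : R, 0 < d & forall k, 0 < k < d ->
    N (k^-1 *: (T k (v 0 h) - v 0 h) - h^-1 *: (T h u - y)) <= e.
Proof.
move=> h0 Ty e e0.
(* With this error [mean_increment] uses half of the budget k * e. The other two quarters pay for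
   replacing k by a multiple m k' of the dyadic step, once in the orbit of the mean and once in the
   coefficient of [T h u - y]. *)
have e1 : 0 < h * e / 2 / 2 by rewrite !divr_gt0// mulr_gt0.
have [d1 d10 Th] := T_cont u (ltW h0) e1.
have [d2 d20 T0] := T_cont u (lexx 0) e1.
exists (Num.min d1 d2); first by rewrite lt_min d10.
move=> k /andP[k0 kd]; rewrite lt_min in kd; case/andP: kd => kd1 kd2.
have -> : k^-1 *: (T k (v 0 h) - v 0 h) - h^-1 *: (T h u - y) =
   k^-1 *: (T k (v 0 h) - v 0 h - (k / h) *: (T h u - y)).
  by rewrite [in RHS]scalerBr scalerA mulrA mulVf ?gt_eqF// mul1r.
rewrite seminormZ gtr0_norm ?invr_gt0// [leLHS]mulrC ler_pdivrMr// [leRHS]mulrC.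
have ke : 0 < k * e by rewrite mulr_gt0.
set D := N (T h u - y).
have D0 : 0 <= D by exact: seminorm_ge0.
have [d3 d30 Tk] := T_cont (v 0 h) (ltW k0) (divr_gt0 ke (ltr0n _ 4)).
(* Solves q / h * (D + 1) = k * e / 4, the bound wanted for the coefficient error; the 1 keeps the
   denominator positive when D = 0. *)
pose q := k * e / 4 * h / (D + 1).
have D1 : 0 < D + 1 by rewrite ltr_wpDl.
have q0 : 0 < q by rewrite divr_gt0// mulr_gt0// divr_gt0.
have mn0 : 0 < Num.min d3 q by rewrite lt_min d30 q0.
(* Makes the dyadic step h / 2^M smaller than both d3 and q, again by M < 2^M. *)
set M := (Num.truncn (h / Num.min d3 q)).+1.
have M2 : h / 2 ^+ M < Num.min d3 q.
  rewrite ltr_pdivrMr ?exprn_gt0// mulrC -ltr_pdivrMr//.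
  rewrite (lt_trans (truncnS_gt _))// -natrX ltr_nat.
  exact: ltn_expl.
set k' := h / 2 ^+ M in M2.
have k'0 : 0 < k' by rewrite divr_gt0// exprn_gt0.
pose m := Num.truncn (k / k').
have km : m%:R * k' <= k < m%:R * k' + k'.
  rewrite -[X in _ < _ + X]mul1r -mulrDl natr1.
  rewrite -ler_pdivlMr// -ltr_pdivrMr//.
  by rewrite truncn_itv// divr_ge0// ltW.
case/andP: km => mk km.
have mk0 : 0 <= m%:R * k' by rewrite mulr_ge0// ltW.
have dk : `|m%:R * k' - k| < Num.min d3 q.
  by rewrite distrC ger0_norm ?subr_ge0// (lt_trans _ M2)// ltrBlDl.
move: dk; rewrite lt_min => /andP[dk3 dkq].
have inc : N (v (m%:R * k') h - v 0 h - (m%:R / 2 ^+ M) *: (T h u - y)) <=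
    (m%:R / 2 ^+ M) * (2 * (h * e / 2 / 2)).
  apply: (@mean_increment _ _ _ _ _ k) => //.
    move=> r /andP[r0 rk]; apply: Th; first by rewrite addr_ge0// ltW.
    by rewrite addrK ger0_norm// (le_lt_trans rk).
  move=> r /andP[r0 rk]; apply: (@eqvN_le (T r u - T 0 u)).
    by apply: eqvD => //; exact: eqvN.
  by apply: T0 => //; rewrite subr0 ger0_norm// (le_lt_trans rk).
have -> : T k (v 0 h) - v 0 h - (k / h) *: (T h u - y) =
  (T k (v 0 h) - T (m%:R * k') (v 0 h)) +
  (T (m%:R * k') (v 0 h) - v 0 h - (m%:R / 2 ^+ M) *: (T h u - y)) +
  (m%:R * k' / h - k / h) *: (T h u - y).
  have -> : m%:R * k' / h = m%:R / 2 ^+ M.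
    by rewrite /k' mulrA [m%:R * h / _]mulrAC -[_ * h / h]mulrA divff ?gt_eqF// mulr1.
  by rewrite scalerBl -[RHS]addrA subrKA -[X in _ = _ + X]addrA subrKA addrA.
rewrite (le_trans (seminormD _ _))//.
have -> : k * e = k * e / 4 + k * e / 2 + k * e / 4 by field.
rewrite lerD//.
  rewrite (le_trans (seminormD _ _))// lerD//.
    by rewrite seminorm_distC Tk.
  apply: (@eqvN_le (v (m%:R * k') h - v 0 h - (m%:R / 2 ^+ M) *: (T h u - y))).
    apply: eqvD => //; apply: eqvD => //; apply: eqvC.
    by have := mean_shift mk0 (lexx 0) (ltW h0); rewrite addr0.
  rewrite (le_trans inc)//.
  have -> : m%:R / 2 ^+ M * (2 * (h * e / 2 / 2)) = m%:R * k' * e / 2.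
    by rewrite /k'; field.
  by rewrite ler_pM2r ?invr_gt0// ler_pM2r.
rewrite seminormZ -mulrBl normrM [`|h^-1|]gtr0_norm ?invr_gt0//.
rewrite (@le_trans _ _ (q / h * (D + 1)))//.
  rewrite ler_pM ?lerDl//.
    by rewrite mulr_ge0// invr_ge0 ltW.
  by rewrite ler_pM2r ?invr_gt0// ltW.
by rewrite le_eqVlt; apply/orP; left; apply/eqP; rewrite /q; field; rewrite !gt_eqF.
Qed.

End mean.

Hypothesis T_0 : forall u, N (T 0 u - u) = 0.

Theorem semigroup_domain_dense u e : 0 < e -> exists v g, N (v - u) <= e /\
  forall e', 0 < e' -> exists2 d : R, 0 < d &
    forall h, 0 < h < d -> N (h^-1 *: (T h v - v) - g) <= e'.
Proof.
move=> e0; have [v vP] := mean_ex u.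
have [d d0 Td] := T_cont u (lexx 0) e0.
have h0 : 0 < d / 2 by rewrite divr_gt0.
(* The mean of the orbit over [0, d / 2] stays near u by continuity at 0, and the generator maps it
   to the difference quotient over that interval. Halving d keeps the closed interval inside the
   open range of continuity. *)
exists (v 0 (d / 2)), ((d / 2)^-1 *: (T (d / 2) u - u)); split; last first.
  by move=> e' e'0; apply: mean_generator => //; exact: T_0.
apply: (seminorm_cvg_le (vP _ _ (lexx 0) (ltW h0))); exists 0 => k _.
apply: dyadic_mean_dist; first exact: ltW.
move=> r /andP[r0 rd]; apply: (@eqvN_le (T r u - T 0 u)).
  by apply: eqvD => //; apply: eqvN; exact: T_0.
apply: Td => //; rewrite subr0 ger0_norm// (le_lt_trans rd)// add0r.
by rewrite ltr_pdivrMr// ltr_pMr// ltr1n.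
Qed.

End seminormed_semigroup.

(** * L^2: seminorm and completeness *)

Section Lnorm2.
Context {d} {X : measurableType d} {R : realType}.
Variable mu : {measure set X -> \bar R}.
Implicit Types (f g : X -> R) (e : R).

Lemma Lnorm2E f :
  ('N[mu]_2[EFin \o f])%E = ((\int[mu]_x (f x ^+ 2)%:E) `^ 2^-1)%E.
Proof.
rewrite unlock; congr (_ `^ _)%E; apply: eq_integral => x _.
by rewrite /= powR_mulrn// real_normK ?num_real.
Qed.

Lemma Lnorm2_le f e : 0 <= e ->
  ('N[mu]_2[EFin \o f] <= e%:E)%E = (\int[mu]_x (f x ^+ 2)%:E <= (e ^+ 2)%:E)%E.
Proof.
move=> e0; rewrite Lnorm2E.
have : (0 <= \int[mu]_x (f x ^+ 2)%:E)%E.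
  by apply: integral_ge0 => x _; rewrite lee_fin sqr_ge0.
case: (\int[mu]_x _)%E => [r| |]//; rewrite ?lee_fin => r0.
  rewrite powR12_sqrt//.
  by rewrite -(ler_sqr (sqrtr_ge0 _) e0) sqr_sqrtr.
by rewrite poweRyr ?invr_eq0 ?pnatr_eq0// !leye_eq.
Qed.

Lemma Lfun2P f :
  f \in Lfun mu 2 <->
  measurable_fun setT f /\ (\int[mu]_x (f x ^+ 2)%:E < +oo)%E.
Proof.
split.
  move=> /[dup] /Lfun2_integrable_sqr /integrable_lty; rewrite /comp => ->//.
  by rewrite inE => /andP[]; rewrite inE.
move=> [mf fy]; rewrite inE; apply/andP; split; rewrite inE//=.
have : (\int[mu]_x (f x ^+ 2)%:E)%E \is a fin_num.
  by rewrite ge0_fin_numE// integral_ge0// => x _; rewrite lee_fin sqr_ge0.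
move=> /fineK fE.
rewrite /finite_norm (@le_lt_trans _ _ (Num.sqrt (\int[mu]_x (f x ^+ 2)))%:E) ?ltry//.
rewrite Lnorm2_le// sqr_sqrtr ?fE//.
by rewrite fine_ge0// integral_ge0// => x _; rewrite lee_fin sqr_ge0.
Qed.

Let p1 : (1 <= (2 : \bar R))%E. Proof. by rewrite lee_fin ler1n. Qed.

Lemma Lfun2D f g : f \in Lfun mu 2 -> g \in Lfun mu 2 -> f \+ g \in Lfun mu 2.
Proof. exact: (Lfun_addr_closed mu p1).2. Qed.

Lemma Lfun2Z a f : f \in Lfun mu 2 -> a \*: f \in Lfun mu 2.
Proof.
move=> f2; have := Lfun_scale (a : R) (ler1n R 2) f2.
by rewrite (_ : a \o* f = a \*: f)//; apply/funext => x /=; rewrite mulrC.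
Qed.

(** [fine] sends an infinite norm to 0, so the triangle inequality and homogeneity are stated for
    members of [Lfun mu 2]. *)
Definition L2norm f := fine ('N[mu]_2[EFin \o f])%E.

Lemma L2normE f : f \in Lfun mu 2 -> ((L2norm f)%:E = 'N[mu]_2[EFin \o f])%E.
Proof.
rewrite inE => /andP[_]; rewrite inE/= /finite_norm => fy.
by rewrite fineK// ge0_fin_numE// Lnorm_ge0.
Qed.

Lemma L2norm_ge0 f : 0 <= L2norm f.
Proof. by rewrite fine_ge0// Lnorm_ge0. Qed.

Lemma sqr_L2norm f : f \in Lfun mu 2 ->
  (L2norm f ^+ 2)%:E = (\int[mu]_x (f x ^+ 2)%:E)%E.
Proof.
move=> f2; have /Lfun2P[_ fy] := f2.
have i0 : (0 <= \int[mu]_x (f x ^+ 2)%:E)%E.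
  by apply: integral_ge0 => x _; rewrite lee_fin sqr_ge0.
move: (i0) (fy); rewrite -ge0_fin_numE// => _ /fineK iE.
apply/eqP; rewrite eq_le -Lnorm2_le ?L2norm_ge0// -L2normE// lexx andbT.
rewrite -iE lee_fin -(@sqr_sqrtr _ (fine _)) ?fine_ge0//.
rewrite ler_sqr ?nnegrE ?L2norm_ge0 ?sqrtr_ge0//.
by rewrite -lee_fin L2normE// Lnorm2_le ?sqrtr_ge0// sqr_sqrtr ?fine_ge0// iE.
Qed.

Lemma L2norm_le f e : f \in Lfun mu 2 -> 0 <= e ->
  (L2norm f <= e) = (\int[mu]_x (f x ^+ 2)%:E <= (e ^+ 2)%:E)%E.
Proof. by move=> f2 e0; rewrite -Lnorm2_le// -L2normE// lee_fin. Qed.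

Lemma L2normD f g : f \in Lfun mu 2 -> g \in Lfun mu 2 ->
  L2norm (f \+ g) <= L2norm f + L2norm g.
Proof.
move=> f2 g2; have fg : f \+ g \in Lfun mu 2 by exact: Lfun2D.
have /Lfun2P[mf _] := f2; have /Lfun2P[mg _] := g2.
rewrite -lee_fin EFinD !L2normE//.
by apply: minkowski_EFin => //; rewrite ler1n.
Qed.

Lemma L2normZ a f : f \in Lfun mu 2 -> L2norm (a \*: f) = `|a| * L2norm f.
Proof.
move=> f2.
have af : a \*: f \in Lfun mu 2 by exact: Lfun2Z.
apply: EFin_inj; rewrite EFinM !L2normE//.
exact: (LnormZ (Lfun_Sub p1 f2)).
Qed.

Lemma ae_eq_Lnorm2 f g : measurable_fun setT f -> measurable_fun setT g ->
  f = g %[ae mu] -> ('N[mu]_2[EFin \o f] = 'N[mu]_2[EFin \o g])%E.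
Proof.
move=> mf mg fg; rewrite !Lnorm2E; congr (_ `^ _)%E.
apply: ae_eq_integral => //.
- by apply/measurable_EFinP; exact: measurable_funX.
- by apply/measurable_EFinP; exact: measurable_funX.
- by apply: filterS fg => x /= /(_ I) ->.
Qed.

Lemma L2norm_eq0 f : f \in Lfun mu 2 -> L2norm f = 0 -> f = \0 %[ae mu].
Proof.
move=> f2 f0; have /Lfun2P[mf _] := f2.
have : (EFin \o f = \0 %[ae mu])%E.
  apply: (@Lnorm_eq0_eq0 _ _ _ _ _ 2) => //; first exact/measurable_EFinP.
  by rewrite -L2normE// f0.
by apply: filterS => x /= /(_ I)[].
Qed.

End Lnorm2.

(** * Completeness of L^2 for sequences of functions *)

Section L2_complete.
Context {d} {X : measurableType d} {R : realType}.
Variable mu : {measure set X -> \bar R}.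
Local Notation N := (L2norm mu).

Lemma Lfun2B f g : f \in Lfun mu 2 -> g \in Lfun mu 2 -> f \- g \in Lfun mu 2.
Proof.
move=> f2 g2; have := Lfun2D f2 (Lfun2Z (-1) g2).
rewrite (_ : f \+ _ = f \- g)//; apply/funext => x /=.
by rewrite scaleN1r.
Qed.

Lemma L2norm_distC f g : N (f \- g) = N (g \- f).
Proof.
rewrite /L2norm; congr fine; rewrite !Lnorm2E; congr (_ `^ _)%E.
by apply: eq_integral => x _ /=; rewrite -sqrrN opprB.
Qed.

Lemma L2norm_dist g f h : f \in Lfun mu 2 -> g \in Lfun mu 2 ->
  h \in Lfun mu 2 -> N (f \- h) <= N (f \- g) + N (g \- h).
Proof.
move=> f2 g2 h2; have := L2normD (Lfun2B f2 g2) (Lfun2B g2 h2).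
rewrite (_ : (f \- g) \+ (g \- h) = f \- h)//; apply/funext => x /=.
by rewrite subrKA.
Qed.

Lemma L2norm_norm f : N (fun x => `|f x|) = N f.
Proof.
rewrite /L2norm; congr fine; rewrite !Lnorm2E; congr (_ `^ _)%E.
by apply: eq_integral => x _ /=; rewrite real_normK// num_real.
Qed.

Lemma Lfun2_norm f : f \in Lfun mu 2 -> (fun x => `|f x|) \in Lfun mu 2.
Proof.
move=> /Lfun2P[mf fy]; apply/Lfun2P; split; first exact: measurableT_comp.
rewrite (le_lt_trans _ fy)//; apply: ge0_le_integral => //.
- by apply/measurable_EFinP; apply: measurable_funX; exact: measurableT_comp.
- by apply/measurable_EFinP; exact: measurable_funX.
- by move=> x _; rewrite real_normK// num_real.
Qed.

(* A sequence with summable increments converges almost everywhere, since the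
   sum of the absolute values of its increments is square integrable. *)
Lemma L2_summable_cvg_ae (g : nat -> X -> R) :
  (forall k, g k \in Lfun mu 2) ->
  (forall k, N (g k.+1 \- g k) <= 2^-1 ^+ k) ->
  {ae mu, forall x, cvgn (fun k => g k x)}.
Proof.
move=> g2 gN.
pose S n x := \sum_(0 <= j < n) `|g j.+1 x - g j x|.
have S_ge0 n x : 0 <= S n x by apply: sumr_ge0.
have SS n x : S n.+1 x = S n x + `|g n.+1 x - g n x|.
  by rewrite /S big_nat_recr.
have dg2 k : g k.+1 \- g k \in Lfun mu 2 by exact: Lfun2B.
(* The bound is the geometric sum of 2^-k over k < n, hence at most 2 for every n. *)
have S2 n : S n \in Lfun mu 2 /\ N (S n) <= 2 - 2 * 2^-1 ^+ n.
  elim: n => [|n [IH1 IH2]].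
    rewrite expr0 mulr1 subrr (_ : S 0 = cst 0); last first.
      by apply/funext => x; rewrite /S big_nil.
    have c2 : cst 0 \in Lfun mu 2.
      by apply/Lfun2P; split => //; rewrite integral0_eq// => x _; rewrite /= expr0n.
    split => //; rewrite L2norm_le// integral0_eq ?lee_fin ?sqr_ge0// => x _.
    by rewrite /= expr0n.
  have -> : S n.+1 = S n \+ (fun x => `|(g n.+1 \- g n) x|).
    by apply/funext => x; rewrite SS.
  split; first by apply: Lfun2D => //; exact: Lfun2_norm.
  rewrite (le_trans (L2normD _ _))//; first exact: Lfun2_norm.
  rewrite L2norm_norm (le_trans (lerD IH2 (gN n)))//.
  by rewrite exprS; lra.
have mS n : measurable_fun setT (S n) by have [/Lfun2P[]] := S2 n.
have mS2 n : measurable_fun setT (fun x => (S n x ^+ 2)%:E).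
  by apply/measurable_EFinP; exact: measurable_funX.
have S20 n x : setT x -> (0 <= (S n x ^+ 2)%:E)%E by rewrite lee_fin sqr_ge0.
have ndS x : setT x -> {homo (fun n => (S n x ^+ 2)%:E) : n m / (n <= m)%N >-> (n <= m)%E}.
  move=> _; apply/nondecreasing_seqP => n; rewrite lee_fin.
  by rewrite ler_sqr ?nnegrE// SS lerDl.
have cv := cvg_monotone_convergence (mu := mu) measurableT mS2 S20 ndS.
have l0 x : (0 <= limn (fun n => (S n x ^+ 2)%:E))%E.
  by apply: lime_ge; [exact/ereal_nondecreasing_is_cvgn/ndS|apply: nearW => n; exact: S20].
have : mu.-integrable setT (fun x => limn (fun n => (S n x ^+ 2)%:E)).
  apply/integrableP; split.
    apply: (emeasurable_fun_cvg (fun n x => (S n x ^+ 2)%:E)) => // x _.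
    exact/ereal_nondecreasing_is_cvgn/ndS.
  under eq_integral do rewrite gee0_abs//.
  rewrite -(cvg_lim _ cv)// (@le_lt_trans _ _ (2 ^+ 2)%:E) ?ltry//.
  apply: lime_le; first by apply/cvg_ex; eexists; exact: cv.
  apply: nearW => n; have [S2n SN] := S2 n.
  rewrite -L2norm_le// (le_trans SN)// gerBl mulr_ge0// exprn_ge0//.
move/(integrable_ae measurableT); apply: filterS => x /(_ I) fin.
have : has_ubound (range (S ^~ x)).
  (* The finite limit bounds the squares, and r <= r^2 + 1 turns this into a bound on the sums
     themselves. *)
  exists (fine (limn (fun n => (S n x ^+ 2)%:E)) + 1) => _ [n _ <-].
  have : S n x ^+ 2 <= fine (limn (fun n => (S n x ^+ 2)%:E)).
    rewrite -lee_fin fineK// (cvg_lim _ (ereal_nondecreasing_cvgn (ndS x I)))//.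
    by apply: ereal_sup_ubound; exists n.
  by have := sqr_ge0 (S n x - 1); nra.
move=> ub; have /normed_cvg cs : cvgn [normed series (telescope (g ^~ x))].
  apply: nondecreasing_is_cvgn ub.
  by apply/nondecreasing_seqP => n; rewrite SS lerDl.
rewrite (_ : (fun k => g k x) = (fun k => g 0 x + series (telescope (g ^~ x)) k)).
  by apply: is_cvgD => //; exact: is_cvg_cst.
by apply/funext => k; rewrite -eq_sum_telescope.
Qed.

(** Riesz-Fischer: a subsequence with increments at most 2^-k converges almost everywhere, and
    Fatou's lemma along it bounds the distance of each [f i] to the limit. *)
Theorem L2_complete (f : nat -> X -> R) : (forall k, f k \in Lfun mu 2) ->
  (forall e : R, 0 < e ->
    exists k, forall i, (k <= i)%N -> N (f i \- f k) <= e) ->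
  exists2 g, g \in Lfun mu 2 & forall e : R, 0 < e ->
    exists k, forall i, (k <= i)%N -> N (f i \- g) <= e.
Proof.
move=> f2 fC.
have f_cauchy (e : R) : 0 < e -> exists k, forall i j, (k <= i)%N -> (k <= j)%N ->
    N (f i \- f j) <= e.
  move=> e0; have [k kP] := fC _ (divr_gt0 e0 (ltr0n _ 2)).
  exists k => i j ki kj; rewrite (le_trans (L2norm_dist _ (f2 k) _))//.
  by rewrite [leRHS]splitr lerD ?kP// L2norm_distC kP.
have [m mP] : exists m : nat -> nat, forall k i j, (m k <= i)%N -> (m k <= j)%N ->
    N (f i \- f j) <= 2^-1 ^+ k.
  suff /choice[m mP] : forall k, exists m, forall i j, (m <= i)%N -> (m <= j)%N ->
    N (f i \- f j) <= 2^-1 ^+ k by exists m.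
  by move=> k; apply: f_cauchy; rewrite exprn_gt0// invr_gt0.
(* The running maximum makes the indices nondecreasing and at least k, while keeping them beyond
   [m k]. *)
pose l k := \max_(i < k.+1) maxn i (m i).
have ml k : (m k <= l k)%N.
  rewrite (leq_trans (leq_maxr k _))//.
  exact: (leq_bigmax (F := fun i : 'I_k.+1 => maxn i (m i)) ord_max).
have kl k : (k <= l k)%N.
  rewrite (leq_trans (leq_maxl k (m k)))//.
  exact: (leq_bigmax (F := fun i : 'I_k.+1 => maxn i (m i)) ord_max).
have ll k : (l k <= l k.+1)%N by rewrite [leqRHS]/l big_ord_recr leq_maxl.
pose g k := f (l k).
have g_cvg : {ae mu, forall x, cvgn (fun k => g k x)}.
  apply: L2_summable_cvg_ae => k; first exact: f2.
  by apply: mP; rewrite ?ml// (leq_trans (ml k)).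
(* An upper limit is measurable whether or not the sequence converges, and it is the limit almost
   everywhere. *)
pose G x := fine (limn_esup (fun k => (g k x)%:E)).
have mf k : measurable_fun setT (f k) by have /Lfun2P[] := f2 k.
have mG : measurable_fun setT G.
  apply: (measurableT_comp (@fine_measurable _ setT measurableT)).
  apply: measurable_fun_limn_esup => k.
  by apply/measurable_EFinP; exact: mf.
have fG i e : 0 < e -> (exists k, forall j, (k <= j)%N -> N (f i \- f j) <= e) ->
    (\int[mu]_x ((f i \- G) x ^+ 2)%:E <= (e ^+ 2)%:E)%E.
  move=> e0 [k kP].
  have mfg n : measurable_fun setT (fun x => ((f i \- g n) x ^+ 2)%:E).
    apply/measurable_EFinP; apply: measurable_funX.
    by apply: measurable_funB; exact: mf.
  rewrite (@ae_eq_integral _ _ _ mu setT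
    (fun x => limn_einf (fun n => ((f i \- g n) x ^+ 2)%:E)))//.
  - have f0 n x : setT x -> (0 <= ((f i \- g n) x ^+ 2)%:E)%E.
      by rewrite lee_fin sqr_ge0.
    apply: (le_trans (fatou mu measurableT mfg f0)).
    rewrite limn_einf_lim; apply: lime_le; first exact: is_cvg_einfs.
    apply: nearW => n; rewrite /einfs /=.
    apply: (@le_trans _ _ (\int[mu]_x ((f i \- g (maxn n k)) x ^+ 2)%:E)%E).
      by apply: ereal_inf_lbound => /=; exists (maxn n k) => //=; rewrite leq_maxl.
    rewrite -L2norm_le ?(ltW e0)//; last exact: (Lfun2B (f2 i) (f2 _)).
    by apply: kP; rewrite (leq_trans _ (kl _))// leq_maxr.
  - by apply/measurable_EFinP; apply: measurable_funX; exact: measurable_funB.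
  - under eq_fun do rewrite -[limn_einf _]oppeK -limn_esupN.
    apply: measurableT_comp => //; apply: measurable_fun_limn_esup => n.
    exact: measurableT_comp.
  apply: filterS g_cvg => x gx _.
  have gG : (g n x)%:E @[n --> \oo] --> (limn (fun k => g k x))%:E.
    by apply: cvg_EFin; [exact: nearW|exact: gx].
  have -> : (f i \- G) x = f i x - limn (fun k => g k x).
    by rewrite /= /G (cvg_limn_einf_sup gG).2.
  have /cvg_limn_einf_sup[] : (fun n => ((f i \- g n) x ^+ 2)%:E) @ \oo -->
      ((f i x - limn (fun k => g k x)) ^+ 2)%:E; last by move=> ->.
  apply: cvg_EFin; first exact: nearW.
  have : (f i x - g n x) @[n --> \oo] --> f i x - limn (fun k => g k x).
    by apply: cvgB; [exact: cvg_cst|exact: gx].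
  by move=> h; apply: (cvgM h h).
have fG2 i : (exists k, forall j, (k <= j)%N -> N (f i \- f j) <= 1) ->
    f i \- G \in Lfun mu 2.
  move=> /(fG i 1 ltr01) fiG; apply/Lfun2P; split; first exact: measurable_funB.
  by rewrite (le_lt_trans fiG)// ltry.
exists G.
  have [k kP] := f_cauchy 1 ltr01.
  have := Lfun2B (f2 k) (fG2 k _).
  rewrite (_ : f k \- (f k \- G) = G); last by apply/funext => x /=; rewrite opprB addrC subrK.
  by apply; exists k => j; apply: kP.
move=> e e0; have [k kP] := f_cauchy _ e0; have [k1 k1P] := f_cauchy 1 ltr01.
exists (maxn k k1) => i; rewrite geq_max => /andP[ki k1i].
rewrite L2norm_le ?(ltW e0)//.
  by apply: fG => //; exists k => j; exact: kP.
by apply: fG2; exists k1 => j; exact: k1P.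
Qed.

End L2_complete.

(** * L^2(Omega) and the density of the domain of the generator *)

Section L2_domain.
Context {R : realType} {n : nat}.
Local Notation X := 'rV[R]_n.
Local Notation mu := (lebesgue n).
Variable Omega : set X.
Hypothesis mOmega : measurable Omega.
Implicit Types (u v f g : X -> R).

Definition L2seminorm u : R := L2norm mu (u \_ Omega).

Lemma restrictD u v : (u \+ v) \_ Omega = (u \_ Omega) \+ (v \_ Omega).
Proof. by apply/funext => x /=; rewrite !patchE; case: ifP => //; rewrite addr0. Qed.

Lemma restrictB u v : (u \- v) \_ Omega = (u \_ Omega) \- (v \_ Omega).
Proof. by apply/funext => x /=; rewrite !patchE; case: ifP => //; rewrite subr0. Qed.

Lemma restrictZ (a : R) u : (a \*: u) \_ Omega = a \*: (u \_ Omega).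
Proof. by apply/funext => x /=; rewrite !patchE; case: ifP => //; rewrite scaler0. Qed.

Lemma integral_sqr_restrict u :
  (\int[mu]_x ((u \_ Omega) x ^+ 2)%:E = \int[mu]_(x in Omega) (u x ^+ 2)%:E)%E.
Proof.
rewrite [RHS]integral_mkcond; apply: eq_integral => x _.
by rewrite !patchE; case: ifP => //; rewrite expr0n.
Qed.

Lemma Lp2P u : Lp Omega 2 u <->
  measurable_fun Omega u /\ (\int[mu]_(x in Omega) (u x ^+ 2)%:E < +oo)%E.
Proof.
rewrite -integral_sqr_restrict /Lp; split.
  by move=> /Lfun2P[/(measurable_restrictT _ mOmega)].
by move=> [/(measurable_restrictT _ mOmega) ? ?]; apply/Lfun2P.
Qed.

Lemma Lp2D u v : Lp Omega 2 u -> Lp Omega 2 v -> Lp Omega 2 (u \+ v).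
Proof. by rewrite /Lp restrictD; exact: Lfun2D. Qed.

Lemma Lp2B u v : Lp Omega 2 u -> Lp Omega 2 v -> Lp Omega 2 (u \- v).
Proof. by rewrite /Lp restrictB; exact: Lfun2B. Qed.

Lemma Lp2Z (a : R) u : Lp Omega 2 u -> Lp Omega 2 (a \*: u).
Proof. by rewrite /Lp restrictZ; exact: Lfun2Z. Qed.

Lemma Lp2_Lfun u : u \in Lfun mu 2 -> Lp Omega 2 u.
Proof.
move=> /Lfun2P[mu_ uy]; apply/Lp2P; split; first exact: measurable_funTS.
rewrite (le_lt_trans _ uy)//; apply: ge0_subset_integral => //.
- by apply/measurable_EFinP; exact: measurable_funX.
- by move=> x _; rewrite lee_fin sqr_ge0.
Qed.

Lemma L2seminorm_ae0 u : Lp Omega 2 u -> (\forall x \ae mu, Omega x -> u x = 0) -> L2seminorm u = 0.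
Proof.
move=> u2 u0; rewrite /L2seminorm /L2norm.
have /Lfun2P[mu_ _] := u2.
rewrite (@ae_eq_Lnorm2 _ _ _ mu _ (cst 0))//.
  by rewrite (_ : EFin \o cst 0 = cst 0%E)// Lnorm0.
by apply: filterS u0 => x u0 _; rewrite patchE; case: ifP => // /set_mem.
Qed.

Lemma L2seminormD u v : Lp Omega 2 u -> Lp Omega 2 v ->
  L2seminorm (u \+ v) <= L2seminorm u + L2seminorm v.
Proof. by move=> u2 v2; rewrite /L2seminorm restrictD L2normD. Qed.

Lemma L2seminormZ (a : R) u : Lp Omega 2 u -> L2seminorm (a \*: u) = `|a| * L2seminorm u.
Proof. by move=> u2; rewrite /L2seminorm restrictZ L2normZ. Qed.

Lemma eq_L2seminorm u v : {in Omega, u =1 v} -> L2seminorm u = L2seminorm v.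
Proof.
move=> uv; rewrite /L2seminorm; congr L2norm; apply/funext => x; rewrite !patchE.
by case: ifP => // /uv.
Qed.

Lemma L2seminorm_le_L2norm u : u \in Lfun mu 2 -> L2seminorm u <= L2norm mu u.
Proof.
move=> u2; have /Lfun2P[mu_ _] := u2.
rewrite /L2seminorm L2norm_le ?L2norm_ge0//; last exact: Lp2_Lfun.
rewrite integral_sqr_restrict sqr_L2norm//.
apply: ge0_subset_integral => //.
- by apply/measurable_EFinP; exact: measurable_funX.
- by move=> x _; rewrite lee_fin sqr_ge0.
Qed.

Lemma Lpnorm_le_L2seminorm u (e : R) : Lp Omega 2 u ->
  (Lpnorm Omega 2 u <= e%:E)%E = (L2seminorm u <= e).
Proof. by move=> u2; rewrite -lee_fin /L2seminorm L2normE. Qed.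

Lemma Lpnorm_cvg0P {I : Type} (F : set_system I) {FF : Filter F} (f : I -> X -> R) :
  (Lpnorm Omega 2 (f i) @[i --> F] --> 0)%E <->
  forall e : R, 0 < e -> \forall i \near F, (Lpnorm Omega 2 (f i) <= e%:E)%E.
Proof.
split=> [f0 e e0|f0].
  have /f0 : nbhs 0%E [set x : \bar R | (x < e%:E)%E].
    by apply: open_ereal_lt'; rewrite lte_fin.
  by move=> h; apply: (@filterS _ F FF _ _ _ h) => i /= /ltW.
apply/fine_cvgP; split.
  by apply: filterS (f0 _ ltr01) => i i1; rewrite ge0_fin_numE ?Lnorm_ge0// (le_lt_trans i1) ?ltry.
apply/cvgrPdist_le => e e0; apply: filterS (f0 _ e0) => i ie /=.
rewrite sub0r normrN ger0_norm ?fine_ge0 ?Lnorm_ge0// -lee_fin fineK//.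
by rewrite ge0_fin_numE ?Lnorm_ge0// (le_lt_trans ie) ?ltry.
Qed.

Variable T : R -> (X -> R) -> X -> R.
Hypothesis C0 : C0_semigroup Omega T.

Lemma C0_continuous u (t e : R) : Lp Omega 2 u -> 0 <= t -> 0 < e ->
  exists2 d : R, 0 < d &
  forall r, 0 <= r -> `|r - t| < d -> L2seminorm (T r u \- T t u) <= e.
Proof.
move=> u2 t0 e0.
have /Lpnorm_cvg0P/(_ _ e0) := semigroup_continuous C0 t0 u2.
case=> d /= d0 dT; exists d => // r r0 rd.
rewrite -Lpnorm_le_L2seminorm; last by apply: Lp2B; exact: (semigroup_L2 C0).
by apply: dT => //=; rewrite distrC.
Qed.

Lemma generatorP u g : generator Omega T u g <->
  [/\ Lp Omega 2 u, Lp Omega 2 g & forall e : R, 0 < e -> exists2 d : R, 0 < d &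
    forall h, 0 < h < d -> L2seminorm (h^-1 \*: (T h u \- u) \- g) <= e].
Proof.
have gL h : 0 <= h -> Lp Omega 2 u -> Lp Omega 2 g ->
    Lp Omega 2 (h^-1 \*: (T h u \- u) \- g).
  by move=> h0 u2 g2; apply/Lp2B/g2/Lp2Z/Lp2B/u2/(semigroup_L2 C0).
split=> [[u2 g2 /Lpnorm_cvg0P ug]|[u2 g2 ug]]; split=> //.
  move=> e /ug[d /= d0 dT]; exists d => // h /andP[h0 hd].
  rewrite -Lpnorm_le_L2seminorm; last by apply: gL => //; exact: ltW.
  by apply: dT => //=; rewrite sub0r normrN gtr0_norm.
apply/Lpnorm_cvg0P => e /ug[d d0 dT].
near=> h; rewrite [leLHS](_ : _ = Lpnorm Omega 2 (h^-1 \*: (T h u \- u) \- g))//.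
rewrite Lpnorm_le_L2seminorm; last by apply: gL.
by apply: dT; apply/andP; split.
Unshelve. all: by end_near. Qed.

Let p1 : (1 <= (2 : \bar R))%E. Proof. by rewrite lee_fin ler1n. Qed.
Let E := LfunType mu p1.
Let EP (f : E) : Lp Omega 2 f.
Proof. by apply: Lp2_Lfun; exact: LfunP. Qed.

(** The abstract theorem asks for operators of the module [E] into itself, so the orbit is cut off
    outside [Omega], where its values are meaningless. For t >= 0 the default 0 of [insubd] is never
    taken. *)
Let S t (f : E) : E := insubd (0 : E) ((T t f) \_ Omega).
Let N (f : E) := L2seminorm f.

Let SE t (f : E) : 0 <= t -> (S t f : X -> R) = (T t f) \_ Omega.
Proof.
move=> t0; rewrite /S [LHS]insubdK//.
by apply: (semigroup_L2 C0) => //; exact: EP.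
Qed.

Let TEP t (f : E) : 0 <= t -> Lp Omega 2 (T t f).
Proof. by move=> t0; exact: (semigroup_L2 C0). Qed.

Let complete (f : nat -> E) : (forall e : R, 0 < e -> exists k, forall i,
  (k <= i)%N -> N (f i - f k) <= e) -> exists v : E, seminorm_cvg N f v.
Proof.
move=> fC.
have [||g g2 fg] := @L2_complete _ _ _ mu (fun k => (f k : X -> R) \_ Omega).
- by move=> k; exact: EP.
- move=> e /fC[k kP]; exists k => i /kP; rewrite /N /L2seminorm.
  by rewrite (_ : (f i - f k : X -> R) = f i \- f k)// restrictB.
- exists (Lfun_Sub p1 g2) => e /fg[k kP]; exists k => i /kP.
  apply: le_trans; rewrite /N.
  rewrite (@eq_L2seminorm _ (((f i : X -> R) \_ Omega) \- g)); last first.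
    by move=> x xO /=; rewrite patchE xO.
  by apply: L2seminorm_le_L2norm; apply: Lfun2B => //; exact: EP.
Qed.

Let ST t (f : E) x : 0 <= t -> x \in Omega -> S t f x = T t f x.
Proof. by move=> t0 xO; rewrite SE// patchE xO. Qed.

Let N_S t (f g : E) : 0 <= t -> N (S t f - g) = L2seminorm (T t f \- g).
Proof.
by move=> t0; apply: eq_L2seminorm => x xO; rewrite -[LHS]/(S t f x - g x) ST.
Qed.

Lemma generator_domain_dense u (e : R) : Lp Omega 2 u -> 0 < e ->
  exists v g, generator Omega T v g /\ L2seminorm (v \- u) <= e.
Proof.
move=> u2 e0; pose u' : E := Lfun_Sub p1 u2.
have [||||||||v [g [vu vg]]] := @semigroup_domain_dense R E N _ _ _ S _ _ _ _ _ u' e e0.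
- by move=> f g; apply: L2seminormD; exact: EP.
- by move=> a f; apply: L2seminormZ; exact: EP.
- exact: complete.
- move=> t a f g t0; rewrite N_S//.
  rewrite (@eq_L2seminorm _ (T t (fun x => a * f x + g x) \-
      (fun x => a * T t f x + T t g x))); last first.
    by move=> x xO; rewrite -[LHS]/(T t (a *: f + g : E) x - (a * S t f x + S t g x)) !ST.
  apply: L2seminorm_ae0.
    apply: Lp2B; first exact: (TEP (a *: f + g) t0).
    exact: Lp2D (Lp2Z a (TEP f t0)) (TEP g t0).
  apply: filterS (semigroup_linear C0 a t0 (EP f) (EP g)) => x /= h xO.
  by rewrite h// subrr.
- move=> t t0; have [M TM] := semigroup_bounded C0 t0; exists M => f.
  rewrite (_ : N (S t f) = L2seminorm (T t f)); last first.
    by apply: eq_L2seminorm => x xO; rewrite ST.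
  rewrite -lee_fin EFinM /N /L2seminorm !L2normE.
  - exact: TM (EP f).
  - exact: (EP f).
  - exact: (TEP f t0).
- move=> t r f t0 r0; rewrite N_S ?addr_ge0//.
  rewrite (@eq_L2seminorm _ (T (t + r) f \- T t (S r f))); last first.
    by move=> x xO /=; rewrite ST.
  apply: L2seminorm_ae0; first exact: Lp2B (TEP f (addr_ge0 t0 r0)) (TEP (S r f) t0).
  have TS : T t (S r f) = T t (T r f) %[ae mu in Omega].
    apply: (semigroup_ae C0 t0 (EP (S r f)) (TEP f r0)).
    by apply: nearW => x xO; rewrite ST// mem_set.
  apply: filterS2 TS (semigroupD C0 t0 r0 (EP f)) => x /= h1 h2 xO.
  by rewrite h1// h2// subrr.
- move=> f t d t0 d0; have [r r0 rP] := C0_continuous (EP f) t0 d0.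
  exists r => // h h0 hr; rewrite N_S//.
  rewrite (@eq_L2seminorm _ (T h f \- T t f)); first exact: rP.
  by move=> x xO; rewrite /= ST.
- move=> f; rewrite N_S//; apply: L2seminorm_ae0; first exact: Lp2B (TEP f (lexx 0)) (EP f).
  by apply: filterS (semigroup0 C0 (EP f)) => x /= h xO; rewrite h// subrr.
exists v, g; split; last first.
  by rewrite (@eq_L2seminorm _ (v \- u'))// => x xO /=; rewrite patchE xO.
apply/generatorP; split; [exact: (EP v)|exact: (EP g)|].
move=> d /vg[r r0 rP]; exists r => // h /andP[h0 hr].
rewrite (@eq_L2seminorm _ (h^-1 *: (S h v - v) - g : E)); first by apply: rP; rewrite h0.
by move=> x xO; rewrite -[RHS]/(h^-1 * (S h v x - v x) - g x) ST// ltW.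
Qed.

End L2_domain.

(** * Positive parts of u - c along the semigroup *)

(** Fix e > 0 and take the supremum of the r <= t with phi r <= phi 0 + e r. By continuity it
    satisfies the same inequality; if it were below t, the slope bound would produce a larger such
    r. Then e tends to 0. *)
Lemma nonincreasing_of_right_slope {R : realType} (phi : R -> R) :
  (forall t e : R, 0 <= t -> 0 < e -> exists2 d : R, 0 < d &
    forall r, 0 <= r -> `|r - t| < d -> `|phi r - phi t| <= e) ->
  (forall t e : R, 0 <= t -> 0 < e -> exists2 d : R, 0 < d &
    forall h, 0 < h < d -> phi (t + h) <= phi t + e * h) ->
  forall t, 0 <= t -> phi t <= phi 0.
Proof.
move=> phic phid t; rewrite le_eqVlt => /predU1P[<-//|t0].
suff phie (e : R) : 0 < e -> phi t <= phi 0 + e * t.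
  apply/ler_addgt0Pr => e e0; rewrite (le_trans (phie _ (divr_gt0 e0 t0)))//.
  by rewrite divfK// gt_eqF.
move=> e0; pose S := [set r | 0 <= r <= t /\ phi r <= phi 0 + e * r].
have S0 : S 0 by split; [rewrite lexx ltW|rewrite mulr0 addr0].
have Sub : has_sup S by split; [exists 0|exists t => r [/andP[]]].
pose m := sup S.
have m0 : 0 <= m by apply: ub_le_sup => //; exact: Sub.2.
have mt : m <= t by apply: ge_sup; [exists 0|move=> r [/andP[]]].
have Sm : phi m <= phi 0 + e * m.
  apply/ler_addgt0Pr => d d0; have [z z0 zP] := phic _ _ m0 d0.
  have [r Sr mr] := sup_adherent z0 Sub.
  have [/andP[r0 rt] pr] := Sr.
  have rm : r <= m by apply: ub_le_sup => //; exact: Sub.2.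
  have : `|phi r - phi m| <= d.
    by apply: zP => //; rewrite distrC ger0_norm ?subr_ge0// ltrBlDr -ltrBlDl.
  rewrite distrC => /(le_trans (ler_norm _)); rewrite lerBlDr => /le_trans; apply.
  rewrite addrC lerD2r (le_trans pr)// lerD2l ler_pM2l//.
have [|mlt] := leP t m; first by move=> tm; have <- : m = t by apply/eqP; rewrite eq_le mt.
have [d d0 dP] := phid _ _ m0 e0.
pose h := Num.min (d / 2) (t - m).
have h0 : 0 < h by rewrite lt_min divr_gt0//= subr_gt0.
have : S (m + h).
  split; first by rewrite addr_ge0 ?(ltW h0)//= -lerBrDl ge_min lexx orbT.
  rewrite (le_trans (dP h _))//.
    rewrite h0 (@le_lt_trans _ _ (d / 2))//; first by rewrite ge_min lexx.
    by rewrite ltr_pdivrMr// ltr_pMr// ltr1n.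
  by rewrite mulrDr addrA lerD2r.
move=> /(ub_le_sup Sub.2); rewrite -/m gerDl leNgt.
by rewrite h0.
Qed.

(** * Pointwise inequalities for the truncation (r - c)^+ *)

Section truncation.
Context {R : realType}.
Implicit Types (r c : R).

Definition trunc c r := Num.max (r - c) 0.

Lemma trunc_ge0 c r : 0 <= trunc c r.
Proof. by rewrite /trunc le_max lexx orbT. Qed.

Lemma trunc_le c r a : r - c <= a -> 0 <= a -> trunc c r <= a.
Proof. by rewrite /trunc ge_max => -> ->. Qed.

Lemma truncP c r : trunc c r = r - c /\ c <= r \/ trunc c r = 0 /\ r <= c.
Proof.
rewrite /trunc; case: (leP 0 (r - c)) => h; [left|right]; split => //; lra.
Qed.

Lemma trunc_eq0 c r : (trunc c r == 0) = (r <= c).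
Proof.
have [[-> h]|[-> h]] := truncP c r; last by rewrite eqxx h.
by rewrite subr_eq0 eq_le h andbT.
Qed.

Lemma trunc_lip c r r' : `|trunc c r - trunc c r'| <= `|r - r'|.
Proof.
have := ler_norm (r - r'); have := ler_norm (r' - r); rewrite distrC ler_norml.
have [[-> h]|[-> h]] := truncP c r; have [[-> h']|[-> h']] := truncP c r' => h1 h2;
  apply/andP; split; lra.
Qed.

Lemma trunc_norm c r : 0 <= c -> `|trunc c r| <= `|r|.
Proof.
move=> c0; rewrite ger0_norm ?trunc_ge0//.
by rewrite trunc_le// (le_trans _ (ler_norm r))// gerBl.
Qed.

Lemma trunc_mono c r r' : 0 <= (r - r') * (trunc c r - trunc c r').
Proof.
have [[-> h]|[-> h]] := truncP c r; have [[-> h']|[-> h']] := truncP c r'.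
- by rewrite opprB addrA subrK -expr2 sqr_ge0.
- by apply: mulr_ge0; lra.
- by apply: mulr_le0; lra.
- by rewrite subrr mulr0.
Qed.

Lemma trunc_mul_ge0 c r : 0 <= c -> 0 <= r * trunc c r.
Proof.
move=> c0; have [[-> h]|[-> h]] := truncP c r; last by rewrite mulr0.
by apply: mulr_ge0; lra.
Qed.

(** Second-order Taylor bound: the square of the truncation has derivative [2 * trunc c r], which is
    2-Lipschitz. Integrated, it bounds the growth of the norm without differentiating under the
    integral. *)
Lemma trunc_sqr_le c r r' :
  trunc c r' ^+ 2 <= trunc c r ^+ 2 + 2 * (trunc c r * (r' - r)) + (r' - r) ^+ 2.
Proof.
have [[-> h]|[-> h]] := truncP c r; have [[-> h']|[-> h']] := truncP c r'.
- by rewrite le_eqVlt; apply/orP; left; apply/eqP; ring.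
- by have := sqr_ge0 (r' - c); rewrite expr0n/=; nra.
- have := mulr_ge0 (_ : 0 <= r' - c) (_ : 0 <= c - r).
  by have := sqr_ge0 (r - c); rewrite !subr_ge0 => + /(_ h' h); nra.
- by have := sqr_ge0 (r' - r); rewrite expr0n/=; nra.
Qed.

Lemma measurable_trunc c : measurable_fun [set: R] (trunc c).
Proof.
apply: measurable_maxr => //; exact: measurable_funB.
Qed.

End truncation.

(** * From dissipativity on truncations to the submarkovian property *)

Section truncation_criterion.
Context {R : realType} {n : nat}.
Local Notation X := 'rV[R]_n.
Local Notation mu := (lebesgue n).
Variable Omega : set X.
Hypothesis mOmega : measurable Omega.
Implicit Types (u v f g : X -> R) (t r h c : R).
Local Notation L2seminorm := (L2seminorm Omega).
Local Notation L2inner := (L2inner Omega).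

Lemma restrictM u v :
  (u \_ Omega) \* (v \_ Omega) = (fun x => u x * v x) \_ Omega.
Proof.
by apply/funext => x /=; rewrite !patchE; case: ifP => //; rewrite mul0r.
Qed.

Lemma L2inner_integrable u v : Lp Omega 2 u -> Lp Omega 2 v ->
  mu.-integrable Omega (EFin \o (fun x => u x * v x)).
Proof.
move=> u2 v2; apply/(integrable_mkcond _ mOmega).
rewrite restrict_EFin -restrictM.
exact/Lfun1_integrable/Lfun2_mul_Lfun1.
Qed.

Lemma L2inner_le u v : Lp Omega 2 u -> Lp Omega 2 v -> L2inner u v <= L2seminorm u * L2seminorm v.
Proof.
move=> u2 v2; have /Lfun2P[mu_ _] := u2; have /Lfun2P[mv_ _] := v2.
have := @hoelder _ _ _ mu _ _ 2 2 mu_ mv_ (ltr0n _ 2) (ltr0n _ 2).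
move=> /(_ _)/wrap[]; first by rewrite [RHS]splitr !div1r.
rewrite -!L2normE// -EFinM => uv; rewrite -lee_fin (le_trans _ uv)// Lnorm1 restrictM.
have i := L2inner_integrable u2 v2.
rewrite /L2inner /Rintegral fineK; last exact: integrable_fin_num.
rewrite integral_mkcond restrict_EFin (le_trans (lee_abs _))//.
apply: le_abse_integral => //; apply: (measurable_int mu).
by move/(integrable_mkcond _ mOmega) : i; rewrite restrict_EFin.
Qed.

Lemma L2innerDr u v w : Lp Omega 2 u -> Lp Omega 2 v -> Lp Omega 2 w ->
  L2inner u (v \+ w) = L2inner u v + L2inner u w.
Proof.
move=> u2 v2 w2; rewrite /L2inner.
rewrite -RintegralD//; try exact: L2inner_integrable.
by apply: eq_Rintegral => x _; rewrite /= mulrDr.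
Qed.

Lemma L2innerZr a u v : Lp Omega 2 u -> Lp Omega 2 v ->
  L2inner u (a \*: v) = a * L2inner u v.
Proof.
move=> u2 v2; rewrite /L2inner.
rewrite -RintegralZl//; try exact: L2inner_integrable.
by apply: eq_Rintegral => x _; rewrite /= mulrCA.
Qed.

Lemma sqr_L2seminorm u : Lp Omega 2 u -> L2seminorm u ^+ 2 = L2inner u u.
Proof.
move=> u2; apply: EFin_inj; rewrite /L2seminorm sqr_L2norm// integral_sqr_restrict.
rewrite /L2inner /Rintegral fineK; last first.
  by apply: integrable_fin_num => //; exact: (L2inner_integrable u2 u2).
by apply: eq_integral => x _; rewrite expr2.
Qed.

Lemma Lp2_trunc c u : 0 <= c -> Lp Omega 2 u -> Lp Omega 2 (trunc c \o u).
Proof.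
move=> c0 /(Lp2P mOmega)[mu_ uy]; apply/(Lp2P mOmega).
have mtu : measurable_fun Omega (trunc c \o u).
  exact: measurableT_comp (measurable_trunc c) mu_.
split => //; rewrite (le_lt_trans _ uy)//; apply: ge0_le_integral => //.
- by move=> x _; rewrite lee_fin sqr_ge0.
- by apply/measurable_EFinP; exact: measurable_funX.
- by apply/measurable_EFinP; exact: measurable_funX.
- move=> x _; rewrite lee_fin -[leLHS]real_normK ?num_real//.
  by rewrite -[leRHS]real_normK ?num_real// ler_sqr ?nnegrE// trunc_norm.
Qed.

Lemma le_L2seminorm u v : Lp Omega 2 u -> Lp Omega 2 v ->
  (forall x, Omega x -> `|u x| <= `|v x|) -> L2seminorm u <= L2seminorm v.
Proof.
move=> u2 v2 uv; rewrite /L2seminorm L2norm_le ?L2norm_ge0// sqr_L2norm//.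
rewrite !integral_sqr_restrict.
have /(Lp2P mOmega)[mu_ _] := u2; have /(Lp2P mOmega)[mv_ _] := v2.
apply: ge0_le_integral => //.
- by move=> x _; rewrite lee_fin sqr_ge0.
- by apply/measurable_EFinP; exact: measurable_funX.
- by apply/measurable_EFinP; exact: measurable_funX.
- move=> x /uv h; rewrite lee_fin -[leLHS]real_normK ?num_real//.
  by rewrite -[leRHS]real_normK ?num_real// ler_sqr ?nnegrE.
Qed.

Lemma ae_eq_L2seminorm u v : Lp Omega 2 u -> Lp Omega 2 v -> u = v %[ae mu in Omega] ->
  L2seminorm u = L2seminorm v.
Proof.
move=> u2 v2 uv; have /Lfun2P[mu_ _] := u2; have /Lfun2P[mv_ _] := v2.
rewrite /L2seminorm /L2norm; congr fine; apply: ae_eq_Lnorm2 => //.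
by apply: filterS uv => x h _; rewrite !patchE; case: ifP => // /set_mem/h.
Qed.

Lemma L2seminorm_eq0 u : Lp Omega 2 u -> L2seminorm u = 0 -> u = cst 0 %[ae mu in Omega].
Proof.
move=> u2 /(L2norm_eq0 u2); apply: filterS => x /(_ I) + xO.
by rewrite patchE mem_set.
Qed.

Lemma L2seminorm_distC u v : L2seminorm (u \- v) = L2seminorm (v \- u).
Proof. by rewrite /L2seminorm !restrictB L2norm_distC. Qed.

Lemma L2seminorm_ge0 u : 0 <= L2seminorm u.
Proof. exact: L2norm_ge0. Qed.

Lemma L2seminorm_trunc_dist c u v : 0 <= c -> Lp Omega 2 u -> Lp Omega 2 v ->
  L2seminorm (trunc c \o u) <= L2seminorm (trunc c \o v) + L2seminorm (u \- v).
Proof.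
move=> c0 u2 v2; have pu := Lp2_trunc c0 u2; have pv := Lp2_trunc c0 v2.
have uv : L2seminorm ((trunc c \o u) \- (trunc c \o v)) <= L2seminorm (u \- v).
  by apply: le_L2seminorm => [||x _]; [exact: Lp2B|exact: Lp2B|exact: trunc_lip].
rewrite (@le_trans _ _ (L2seminorm ((trunc c \o v) \+ ((trunc c \o u) \- (trunc c \o v)))))//.
  rewrite le_eqVlt; apply/orP; left; apply/eqP.
  by apply: eq_L2seminorm => x _ /=; rewrite addrC subrK.
by rewrite (le_trans (L2seminormD pv (Lp2B pu pv)))// lerD2l.
Qed.

Variable T : R -> (X -> R) -> X -> R.
Hypothesis C0 : C0_semigroup Omega T.

Let TL t u : 0 <= t -> Lp Omega 2 u -> Lp Omega 2 (T t u).
Proof. exact: (semigroup_L2 C0). Qed.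

Lemma semigroup_zero t : 0 <= t -> T t (cst 0) = cst 0 %[ae mu in Omega].
Proof.
move=> t0; have z2 : Lp Omega 2 (cst 0 : X -> R).
  apply/(Lp2P mOmega); split; first exact: measurable_cst.
  by rewrite integral0_eq// => x _; rewrite /= expr0n.
(* Linearity at the zero function gives T 0 = T 0 + T 0. *)
have := semigroup_linear C0 1 t0 z2 z2.
rewrite (_ : (fun x : X => 1 * cst 0 x + cst 0 x) = cst 0); last first.
  by apply/funext => x /=; rewrite mulr0 addr0.
apply: filterS => x /= h /h; rewrite mul1r => /eqP.
by rewrite -[eqbLHS]addr0 (inj_eq (addrI _)) => /eqP <-.
Qed.

Lemma semigroupZ t a u : 0 <= t -> Lp Omega 2 u ->
  T t (a \*: u) = a \*: T t u %[ae mu in Omega].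
Proof.
move=> t0 u2; have z2 : Lp Omega 2 (cst 0 : X -> R).
  apply/(Lp2P mOmega); split; first exact: measurable_cst.
  by rewrite integral0_eq// => x _; rewrite /= expr0n.
have := semigroup_linear C0 a t0 u2 z2.
rewrite (_ : (fun x : X => a * u x + cst 0 x) = a \*: u); last first.
  by apply/funext => x /=; rewrite addr0.
apply: filterS2 (semigroup_zero t0) => x /= z h xO.
by rewrite h// z// addr0.
Qed.

Lemma semigroupB t u v : 0 <= t -> Lp Omega 2 u -> Lp Omega 2 v ->
  T t (u \- v) = T t u \- T t v %[ae mu in Omega].
Proof.
move=> t0 u2 v2; have := semigroup_linear C0 (-1) t0 v2 u2.
rewrite (_ : (fun x : X => -1 * v x + u x) = u \- v); last first.
  by apply/funext => x /=; rewrite mulN1r addrC.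
by apply: filterS => x /= h xO; rewrite h// mulN1r addrC.
Qed.

(** [T t] is bounded and, up to null sets, commutes with the difference quotients because t + h = h
    + t. *)
Lemma generator_shift t u g : 0 <= t -> generator Omega T u g ->
  generator Omega T (T t u) (T t g).
Proof.
move=> t0 /(generatorP C0)[u2 g2 ug].
apply/(generatorP C0); split; [exact: TL|exact: TL|].
have [M TM] := semigroup_bounded C0 t0.
move=> e e0; have M0 : 0 < `|M| + 1 by rewrite ltr_wpDl.
have [d d0 dP] := ug _ (divr_gt0 e0 M0); exists d => // h hd.
have h0 : 0 <= h by case/andP: hd => /ltW.
have q2 := Lp2B (TL h0 u2) u2.
have F2 := Lp2B (Lp2Z h^-1 q2) g2.
rewrite (@ae_eq_L2seminorm _ (T t (h^-1 \*: (T h u \- u) \- g))); first last.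
- have e1 := semigroupB t0 (Lp2Z h^-1 q2) g2.
  have e2 := semigroupZ h^-1 t0 q2.
  have e3 := semigroupB t0 (TL h0 u2) u2.
  have e4 := semigroupD C0 h0 t0 u2.
  have e5 := semigroupD C0 t0 h0 u2; rewrite addrC in e5.
  apply: filterS2 e1 (filterI e2 (filterI e3 (filterI e4 e5))).
  move=> x /= h1 [h2 [h3 [h4 h5]]] xO.
  by rewrite h1//= h2//= h3//= -h4// h5.
- exact: TL.
- exact: Lp2B (Lp2Z _ (Lp2B (TL h0 (TL t0 u2)) (TL t0 u2))) (TL t0 g2).
have := TM _ F2; rewrite /Lpnorm -!L2normE//; last exact: (TL t0 F2).
rewrite -EFinM lee_fin => /le_trans; apply.
rewrite (@le_trans _ _ ((`|M| + 1) * L2seminorm (h^-1 \*: (T h u \- u) \- g)))//.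
  by rewrite ler_wpM2r ?L2seminorm_ge0// (le_trans (ler_norm _))// lerDl.
by rewrite mulrC -ler_pdivlMr// dP.
Qed.

(** For the semigroup of a form [a], testing the generator against P u turns this into a(u, P u) >=
    0. *)
Hypothesis trunc_dissipative : forall c u g, 0 <= c -> generator Omega T u g ->
  L2inner (trunc c \o u) g <= 0.

(** Write T h u - u = h (g + r) with r small and apply [trunc_sqr_le]: the leading term 2 h (P u, g)
    has the right sign, and the rest is at most e * h. *)
Lemma trunc_slope c u g e : 0 <= c -> generator Omega T u g -> 0 < e ->
  exists2 d : R, 0 < d & forall h, 0 < h < d ->
    L2seminorm (trunc c \o T h u) ^+ 2 <= L2seminorm (trunc c \o u) ^+ 2 + e * h.
Proof.
move=> c0 gug e0; have /(generatorP C0)[u2 g2 ug] := gug.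
have p2 := Lp2_trunc c0 u2.
pose A := L2seminorm (trunc c \o u); pose G := L2seminorm g.
have A0 : 0 <= A := L2seminorm_ge0 _; have G0 : 0 <= G := L2seminorm_ge0 _.
(* The constants split e * h in two: |r| <= e / (4 (A + 1)) makes 2 h (P u, r) at most h e / 2,
   while |r| <= 1 and h <= e / (2 (G + 1)^2) do the same for h^2 |g + r|^2. *)
have A1 : 0 < 4 * (A + 1) by rewrite mulr_gt0// ltr_wpDl.
have G1 : 0 < 2 * (G + 1) ^+ 2 by rewrite mulr_gt0// exprn_gt0// ltr_wpDl.
have q0 : 0 < Num.min 1 (e / (4 * (A + 1))) by rewrite lt_min ltr01 divr_gt0.
have [d d0 dP] := ug _ q0.
exists (Num.min d (e / (2 * (G + 1) ^+ 2))); first by rewrite lt_min d0 divr_gt0.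
move=> h /andP[h0]; rewrite lt_min => /andP[hd hG].
have := dP h; rewrite h0 hd => /(_ isT).
set r := _ \- g; rewrite le_min => /andP[r1 rA].
have Th2 := TL (ltW h0) u2.
have r2 : Lp Omega 2 r := Lp2B (Lp2Z _ (Lp2B Th2 u2)) g2.
have d2 := Lp2B Th2 u2; have pT2 := Lp2_trunc c0 Th2.
have dE : T h u \- u = h \*: (g \+ r).
  by apply/funext => x; rewrite /r /= [g x + _]addrC subrK scalerA divff ?scale1r ?gt_eqF.
have le1 : L2seminorm (trunc c \o T h u) ^+ 2 <=
    A ^+ 2 + 2 * L2inner (trunc c \o u) (T h u \- u) + L2seminorm (T h u \- u) ^+ 2.
  rewrite /A !sqr_L2seminorm//.
  have i1 := L2inner_integrable p2 p2; have i2 := L2inner_integrable p2 d2.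
  have i3 := L2inner_integrable d2 d2; have i4 := L2inner_integrable pT2 pT2.
  rewrite /L2inner -RintegralZl//.
  have i2' : mu.-integrable Omega (EFin \o (fun x => 2 * ((trunc c \o u) x * (T h u \- u) x))).
    exact: (integrableZl mOmega 2 i2).
  rewrite -RintegralD// -RintegralD//; last exact: (integrableD mOmega i1 i2').
  apply: le_Rintegral => //.
    exact: (integrableD mOmega (integrableD mOmega i1 i2') i3).
  by move=> x _; rewrite -!expr2; exact: trunc_sqr_le.
rewrite (le_trans le1)// -addrA lerD2l dE L2innerZr//; last exact: Lp2D.
rewrite L2innerDr// L2seminormZ; last exact: Lp2D.
have Lr : L2inner (trunc c \o u) r <= e / 4.
  rewrite (le_trans (L2inner_le p2 r2))// (le_trans (ler_wpM2l A0 rA))//.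
  by rewrite mulrA ler_pdivrMr//; nra.
have nr : L2seminorm (g \+ r) <= G + 1 by rewrite (le_trans (L2seminormD g2 r2))// lerD2l.
have Lg := trunc_dissipative c0 gug.
have n0 := L2seminorm_ge0 (g \+ r).
rewrite gtr0_norm//.
rewrite ltr_pdivlMr// in hG.
have hn : h * L2seminorm (g \+ r) ^+ 2 <= e / 2.
  have : L2seminorm (g \+ r) ^+ 2 <= (G + 1) ^+ 2 by rewrite ler_sqr ?nnegrE// addr_ge0.
  by nra.
by nra.
Qed.

Lemma trunc_ae_eq c u v : u = v %[ae mu in Omega] ->
  trunc c \o u = trunc c \o v %[ae mu in Omega].
Proof. by apply: filterS => x /= h xO; rewrite h. Qed.

Lemma trunc_decay_domain c u g t : 0 <= c -> generator Omega T u g -> 0 <= t ->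
  L2seminorm (trunc c \o T t u) <= L2seminorm (trunc c \o u).
Proof.
move=> c0 gug t0; have /(generatorP C0)[u2 _ _] := gug.
pose phi r := L2seminorm (trunc c \o T r u) ^+ 2.
suff : phi t <= phi 0.
  rewrite /phi ler_sqr ?nnegrE ?L2seminorm_ge0// => /le_trans; apply.
  rewrite le_eqVlt; apply/orP; left; apply/eqP; apply: ae_eq_L2seminorm.
  - by apply: Lp2_trunc => //; exact: TL.
  - exact: Lp2_trunc.
  - exact/trunc_ae_eq/(semigroup0 C0).
apply: nonincreasing_of_right_slope t0 => {}t e {}t0 e0.
  (* Continuity of phi: |b - a| <= q <= 1 gives |b^2 - a^2| <= q (2 a + 1). *)
  pose a := L2seminorm (trunc c \o T t u); have a0 : 0 <= a := L2seminorm_ge0 _.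
  have a1 : 0 < 2 * a + 1 by rewrite ltr_wpDl// mulr_ge0.
  have q0 : 0 < Num.min 1 (e / (2 * a + 1)) by rewrite lt_min ltr01 divr_gt0.
  have [d d0 dP] := C0_continuous C0 u2 t0 q0.
  exists d => // r r0 rt.
  have := dP r r0 rt; set q := L2seminorm _; rewrite le_min => /andP[q1 qe].
  rewrite ler_pdivlMr// in qe.
  have h1 := L2seminorm_trunc_dist c0 (TL r0 u2) (TL t0 u2); rewrite -/q -/a in h1.
  have h2 := L2seminorm_trunc_dist c0 (TL t0 u2) (TL r0 u2); rewrite L2seminorm_distC -/q -/a in h2.
  have b0 := L2seminorm_ge0 (trunc c \o T r u); rewrite /phi -/a.
  set b := L2seminorm _ in h1 h2 b0 *.
  have ab : `|b - a| <= q by rewrite ler_norml; apply/andP; split; lra.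
  have qq : 0 <= q := L2seminorm_ge0 _.
  rewrite subr_sqr normrM (ger0_norm (addr_ge0 b0 a0)).
  rewrite (le_trans _ qe)// ler_pM ?addr_ge0//.
  lra.
(* The slope at t is the slope at 0 of the orbit started from [T t u], which is again in the
   domain. *)
have [d d0 dP] := trunc_slope c0 (generator_shift t0 gug) e0.
exists d => // h hd; have h0 : 0 <= h by case/andP: hd => /ltW.
rewrite (le_trans _ (dP h hd))// /phi le_eqVlt; apply/orP; left; apply/eqP.
congr (_ ^+ 2); apply: ae_eq_L2seminorm.
- by apply: Lp2_trunc => //; apply: TL => //; exact: addr_ge0.
- by apply: Lp2_trunc => //; apply: TL => //; exact: TL.
- by apply: trunc_ae_eq; rewrite addrC; exact: (semigroupD C0).
Qed.

Lemma trunc_decay c u t : 0 <= c -> Lp Omega 2 u -> 0 <= t ->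
  L2seminorm (trunc c \o T t u) <= L2seminorm (trunc c \o u).
Proof.
move=> c0 u2 t0; have [M TM] := semigroup_bounded C0 t0.
(* Replacing u by v costs their distance once at time 0 and at most |M| times at time t. *)
have M0 : 0 < 1 + `|M| + 1 by rewrite ltr_wpDl// addr_ge0.
apply/ler_addgt0Pr => e e0.
have [v [g [gvg vu]]] := generator_domain_dense mOmega C0 u2 (divr_gt0 e0 M0).
have [v2 _ _] := gvg.
have uv : L2seminorm (T t u \- T t v) <= `|M| * L2seminorm (v \- u).
  rewrite (@ae_eq_L2seminorm _ (T t (u \- v))); first last.
  - by apply: filterS (semigroupB t0 u2 v2) => x /= h xO; rewrite h.
  - by apply: TL => //; exact: Lp2B.
  - exact: Lp2B (TL t0 u2) (TL t0 v2).
  have w2 := Lp2B u2 v2.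
  have := TM _ w2; rewrite /Lpnorm -!L2normE//; last exact: (TL t0 w2).
  rewrite -EFinM lee_fin => /le_trans; apply.
  by rewrite [leRHS]mulrC L2seminorm_distC mulrC ler_wpM2r ?L2seminorm_ge0// ler_norm.
have h1 := L2seminorm_trunc_dist c0 (TL t0 u2) (TL t0 v2).
have h2 := trunc_decay_domain c0 gvg t0.
have h3 := L2seminorm_trunc_dist c0 v2 u2.
rewrite ler_pdivlMr// in vu; have := L2seminorm_ge0 (v \- u).
have := normr_ge0 M; nra.
Qed.

Lemma le_semigroup c u t : 0 <= c -> Lp Omega 2 u -> 0 <= t ->
  (\forall x \ae mu, Omega x -> u x <= c) ->
  (\forall x \ae mu, Omega x -> T t u x <= c).
Proof.
move=> c0 u2 t0 uc.
have p0 : L2seminorm (trunc c \o u) = 0.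
  apply: L2seminorm_ae0; first exact: Lp2_trunc.
  by apply: filterS uc => x h xO; apply/eqP; rewrite /= trunc_eq0 h.
have : L2seminorm (trunc c \o T t u) = 0.
  by apply/eqP; rewrite eq_le L2seminorm_ge0 andbT -p0 trunc_decay.
move=> /L2seminorm_eq0 - /(_ (Lp2_trunc c0 (TL t0 u2))).
by apply: filterS => x /= h xO; rewrite -trunc_eq0 h.
Qed.

Lemma ge_semigroup c u t : 0 <= c -> Lp Omega 2 u -> 0 <= t ->
  (\forall x \ae mu, Omega x -> - u x <= c) ->
  (\forall x \ae mu, Omega x -> - T t u x <= c).
Proof.
move=> c0 u2 t0 uc.
have := @le_semigroup c (-1 \*: u) t c0 (Lp2Z _ u2) t0 _.
move=> /(_ _)/wrap[]; first by apply: filterS uc => x h xO /=; rewrite scaleN1r h.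
apply: filterS2 (semigroupZ (-1) t0 u2) => x /= h1 h2 xO.
by have := h2 xO; rewrite h1//= scaleN1r.
Qed.

Theorem submarkovian_of_trunc_dissipative : submarkovian Omega T.
Proof.
split=> [t u t0 u2 u0|t u t0 u2 uy].
  have := @ge_semigroup 0 u t (lexx 0) u2 t0.
  move=> /(_ _)/wrap[]; first by apply: filterS u0 => x h xO; rewrite oppr_le0 h.
  by apply: filterS => x h xO; rewrite -oppr_le0 h.
have uy' : (Lpnorm Omega +oo u < +oo)%E by move: uy; rewrite /Lp inE => /andP[_]; rewrite inE.
have uN : Lpnorm Omega +oo u = (fine (Lpnorm Omega +oo u))%:E.
  by rewrite fineK// ge0_fin_numE// Lnorm_ge0.
have c0 : 0 <= fine (Lpnorm Omega +oo u) by rewrite fine_ge0// Lnorm_ge0.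
move: uN c0; set c := fine _ => uN c0.
(* The norm with exponent [+oo] is an essential supremum only if the measure is nonzero; otherwise
   both sides are 0 by convention. *)
have [mu0|mu0] := boolP (0 < mu [set: X])%E; last first.
  by rewrite /Lpnorm unlock (negbTE mu0).
have uc : \forall x \ae mu, Omega x -> `|u x| <= c.
  move: uN; rewrite /Lpnorm unlock mu0 => uN.
  have : (ess_sup mu (abse \o (EFin \o u \_ Omega)) <= c%:E)%E by rewrite uN.
  by move/ess_supP; apply: filterS => x /= + xO; rewrite patchE mem_set// lee_fin.
rewrite uN /Lpnorm unlock mu0; apply/ess_supP.
have h1 : \forall x \ae mu, Omega x -> T t u x <= c.
  apply: le_semigroup => //; apply: filterS uc => x h xO.
  by rewrite (le_trans (ler_norm _))// h.
have h2 : \forall x \ae mu, Omega x -> - T t u x <= c.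
  apply: ge_semigroup => //; apply: filterS uc => x h xO.
  by rewrite (le_trans (ler_norm _))// normrN h.
apply: filterS2 h1 h2 => x /= h1 h2.
rewrite patchE; case: ifPn => [/set_mem xO|_]; last by rewrite normr0 lee_fin.
by rewrite lee_fin ler_norml lerNl h2// h1.
Qed.

End truncation_criterion.

(** * Borel sets of R^n and the singular kernel *)

Section rV_measure.
Context {R : realType} {n : nat}.
Local Notation X := 'rV[R]_n.
Local Notation mu := (lebesgue n).

(** An open set is the union of the boxes with rational centre and half-width 1 / (k + 1) that it
    contains, a countable family. *)
Lemma measurable_open_rV (U : set X) : open U -> measurable U.
Proof.
move=> oU.
pose box (p : 'rV[rat]_n * nat) : set X :=
  [set x | forall i, x 0 i \in `]ratr (p.1 0 i) - p.2.+1%:R^-1, ratr (p.1 0 i) + p.2.+1%:R^-1]].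
rewrite (_ : U = \bigcup_p (if `[< box p `<=` U >] then box p else set0)).
  apply: countable_bigcupT_measurable; [exact: countableP|move=> p]; case: ifPn => // _.
  exact: measurable_box.
apply/seteqP; split=> [x Ux|x [p _]]; last by case: ifPn => // /asboolP; apply.
have /nbhs_ballP[e /= e0 eU] : nbhs x U by exact: open_nbhs_nbhs.
(* A rational centre within 1 / (m + 1) of x has its whole box within 2 / (m + 1) < e of x. *)
pose m := Num.truncn (2 / e).
have m0 : 0 < m.+1%:R^-1 :> R by rewrite invr_gt0.
have me : 2 * m.+1%:R^-1 < e.
  by rewrite ltr_pdivrMr// -ltr_pdivrMl// mulrC truncnS_gt.
have [q qP] : exists q : 'I_n -> rat, forall i, `|ratr (q i) - x 0 i| < m.+1%:R^-1.
  suff /choice[q qP] : forall i, exists q : rat, `|ratr q - x 0 i| < m.+1%:R^-1 by exists q.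
  move=> i; have [|q] := @rat_in_itvoo R (x 0 i - m.+1%:R^-1) (x 0 i + m.+1%:R^-1).
    by rewrite ltrBlDr -addrA ltrDl addr_gt0.
  by rewrite in_itv/= => /andP[q1 q2]; exists q; rewrite ltr_norml ltrBrDl q1 ltrBlDl.
exists (\row_i q i, m) => //; case: ifPn => [_ i /=|/asboolP].
  have := qP i; rewrite ltr_norml in_itv/= mxE => /andP[q1 q2].
  by move: (m.+1%:R^-1) q1 q2 => r q1 q2; apply/andP; split; lra.
case=> y /= yb; apply: eU; split => // i j; rewrite ord1 -ball_normE /=.
have := yb j; have := qP j; rewrite in_itv/= mxE !ltr_norml => /andP[q1 q2] /andP[y1 y2].
by move: (m.+1%:R^-1) me q1 q2 y1 y2 => r me q1 q2 y1 y2; apply/andP; split; lra.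
Qed.

Lemma measurable_closed_rV (U : set X) : closed U -> measurable U.
Proof.
move=> cU; rewrite -[U]setCK; apply: measurableC; apply: measurable_open_rV.
exact: closed_openC.
Qed.

Lemma lebesgue_bounded_lty (U : set X) : measurable U -> bounded_set U ->
  (mu U < +oo)%E.
Proof.
move=> mU [M [Mr MU]].
have M0 : 0 < `|M| + 1 :> R by rewrite ltr_wpDl.
have UM x : U x -> `|x| <= `|M| + 1.
  by apply: MU; rewrite (le_lt_trans (ler_norm M))// ltrDl.
(* The margin beyond [|M| + 1] takes care of the open left ends of the box. *)
have Ub : U `<=` [set x : X | forall i, x 0 i \in `](- (`|M| + 2)), (`|M| + 2)]].
  move=> x /UM xM i; rewrite in_itv/=.
  have : `|x 0 i| <= `|M| + 1.
    apply: le_trans xM; rewrite [leRHS]mx_normrE.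
    exact: (le_bigmax _ (fun ij : 'I_1 * 'I_n => `|x ij.1 ij.2|) (0, i)).
  rewrite ler_norml => /andP[h1 h2]; apply/andP; split; lra.
apply: (le_lt_trans (le_measure _ _ _ Ub)).
- by rewrite inE.
- by rewrite inE; exact: measurable_box.
- have /= -> := @lebesgue_box R n (fun=> - (`|M| + 2)) (fun=> `|M| + 2) _; first exact: ltry.
  by move=> _; rewrite -subr_ge0; lra.
Qed.

End rV_measure.

Section kernel.
Context {R : realType} {n : nat}.
Local Notation X := 'rV[R]_n.
Local Notation mu := (lebesgue n).
Variable s : R.
Hypothesis s0 : 0 < s.
Local Notation K := (sing_kernel s).

Lemma enorm_ge0 (x : X) : 0 <= enorm x.
Proof. exact: sqrtr_ge0. Qed.

Lemma enormN (x : X) : enorm (- x) = enorm x.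
Proof. by rewrite /enorm; congr Num.sqrt; apply: eq_bigr => i _; rewrite mxE sqrrN. Qed.

Lemma enorm_ge_coord (x : X) i : `|x 0 i| <= enorm x.
Proof.
rewrite /enorm -sqrtr_sqr ler_wsqrtr// (bigD1 i)//= lerDl.
by apply: sumr_ge0 => j _; exact: sqr_ge0.
Qed.

Lemma sing_kernel_ge0 (x y : X) : 0 <= K x y.
Proof. by rewrite invr_ge0 powR_ge0. Qed.

Lemma sing_kernelC (x y : X) : K x y = K y x.
Proof. by rewrite /sing_kernel -enormN opprB. Qed.

Lemma measurable_sing_kernel d (T : measurableType d) (f g : T -> X) :
  measurable_fun setT f -> measurable_fun setT g ->
  measurable_fun setT (fun t => K (f t) (g t)).
Proof.
move=> mf mg; under eq_fun do rewrite /sing_kernel -powRN.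
apply: (measurableT_comp (measurable_powR _)).
apply: (measurableT_comp (continuous_measurable_fun (@sqrt_continuous R))).
apply: measurable_sum => i; apply: measurable_funX.
under eq_fun do rewrite !mxE.
by apply: measurable_funB; exact: measurableT_comp (measurable_coord_rV i) _.
Qed.

(** Some sup-norm ball around x misses [Omega], and the Euclidean norm dominates the sup norm. This
    makes all kernel integrals at an exterior point finite. *)
Lemma sing_kernel_bounded (Omega : set X) x : ~ closure Omega x ->
  exists C, forall y, Omega y -> K x y <= C.
Proof.
move=> xO.
have : nbhs x (~` closure Omega).
  by apply: open_nbhs_nbhs; split => //; apply: closed_openC; exact: closed_closure.
move=> /nbhs_ballP[e /= e0 eO].
exists (e `^ (n%:R + 2 * s))^-1 => y Oy.
have p0 : 0 <= n%:R + 2 * s by rewrite addr_ge0// mulr_ge0// ltW.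
have exy : e <= enorm (x - y).
  rewrite leNgt; apply/negP => xye; apply: (eO y); last exact: subset_closure.
  split => // i j; rewrite ord1 -ball_normE /=.
  by rewrite (le_lt_trans _ xye)//; have := enorm_ge_coord (x - y) j; rewrite !mxE.
rewrite lef_pV2 ?posrE ?powR_gt0//; last exact: lt_le_trans exy.
by rewrite ge0_ler_powR ?nnegrE ?enorm_ge0// ltW.
Qed.

End kernel.

(** * Tonelli and Fubini on a rectangle A x B *)

Section fubini_set.
Context {d1 d2} {T1 : measurableType d1} {T2 : measurableType d2} {R : realType}.
Variables (m1 : {sigma_finite_measure set T1 -> \bar R}).
Variables (m2 : {sigma_finite_measure set T2 -> \bar R}).
Variables (A : set T1) (B : set T2).
Hypotheses (mA : measurable A) (mB : measurable B).

Let patchX (f : T1 * T2 -> \bar R) x :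
  (\int[m2]_y (f \_ (A `*` B)) (x, y) = ((fun x => \int[m2]_(y in B) f (x, y)) \_ A) x)%E.
Proof.
rewrite [RHS]patchE; case: ifPn => xA.
  rewrite [RHS]integral_mkcond; apply: eq_integral => y _.
  by rewrite !patchE in_setX xA.
by apply: integral0_eq => y _; rewrite patchE in_setX (negbTE xA).
Qed.

Let patchY (f : T1 * T2 -> \bar R) y :
  (\int[m1]_x (f \_ (A `*` B)) (x, y) = ((fun y => \int[m1]_(x in A) f (x, y)) \_ B) y)%E.
Proof.
rewrite [RHS]patchE; case: ifPn => yB.
  rewrite [RHS]integral_mkcond; apply: eq_integral => x _.
  by rewrite !patchE in_setX yB andbT.
by apply: integral0_eq => x _; rewrite patchE in_setX (negbTE yB) andbF.
Qed.

Section tonelli.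
Variable f : T1 * T2 -> \bar R.
Hypothesis mf : measurable_fun setT f.
Hypothesis f0 : forall z, (0 <= f z)%E.

Let mfAB : measurable_fun setT (f \_ (A `*` B)).
Proof.
apply/(measurable_restrictT _ (measurableX mA mB)).
exact: measurable_funTS.
Qed.

Let fAB0 z : (0 <= (f \_ (A `*` B)) z)%E.
Proof. by rewrite patchE; case: ifP. Qed.

Lemma tonelli_set1 :
  (\int[m1 \x m2]_(z in A `*` B) f z = \int[m1]_(x in A) \int[m2]_(y in B) f (x, y))%E.
Proof.
rewrite integral_mkcond fubini_tonelli1// [RHS]integral_mkcond.
by apply: eq_integral => x _; exact: patchX.
Qed.

Lemma tonelli_set2 :
  (\int[m1 \x m2]_(z in A `*` B) f z = \int[m2]_(y in B) \int[m1]_(x in A) f (x, y))%E.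
Proof.
rewrite integral_mkcond fubini_tonelli2// [RHS]integral_mkcond.
by apply: eq_integral => y _; exact: patchY.
Qed.

Lemma measurable_tonelli_set1 :
  measurable_fun A (fun x => \int[m2]_(y in B) f (x, y))%E.
Proof.
apply/(measurable_restrictT _ mA).
rewrite (_ : _ \_ A = fubini_F m2 (f \_ (A `*` B))); last first.
  by apply/funext => x; rewrite /fubini_F patchX.
exact: measurable_fun_fubini_tonelli_F.
Qed.

End tonelli.

Section fubini.
Variable f : T1 * T2 -> R.
Hypothesis fi : (m1 \x m2)%E.-integrable (A `*` B) (EFin \o f).

Let fiT : (m1 \x m2)%E.-integrable setT ((EFin \o f) \_ (A `*` B)).
Proof. exact/(integrable_mkcond _ (measurableX mA mB)). Qed.

Let G1 := fubini_F m2 ((EFin \o f) \_ (A `*` B)).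
Let G2 := fubini_G m1 ((EFin \o f) \_ (A `*` B)).

Let patch1 : (EFin \o (fun x => \int[m2]_(y in B) f (x, y))) \_ A = EFin \o (fine \o G1).
Proof.
apply/funext => x; rewrite /G1 /fubini_F /= patchX !patchE.
by case: ifPn => // _; rewrite /= /Rintegral.
Qed.

Let patch2 : (EFin \o (fun y => \int[m1]_(x in A) f (x, y))) \_ B = EFin \o (fine \o G2).
Proof.
apply/funext => y; rewrite /G2 /fubini_G /= patchY !patchE.
by case: ifPn => // _; rewrite /= /Rintegral.
Qed.

(** Iterated real integrals apply [fine] to the inner integral; for an integrable function this
    changes values on a null set only. *)
Let integrable_fine d (T : measurableType d) (m : {measure set T -> \bar R})
  (G : T -> \bar R) : m.-integrable setT G ->
  m.-integrable setT (EFin \o (fine \o G)) /\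
  (\int[m]_x (fine (G x))%:E = \int[m]_x G x)%E.
Proof.
move=> iG; have mG := measurable_int m iG.
have mfG : measurable_fun setT (EFin \o (fine \o G)).
  by apply/measurable_EFinP; exact: measurableT_comp (@fine_measurable _ setT measurableT) mG.
split.
  apply: (le_integrable measurableT mfG _ iG) => x _ /=.
  by case: (G x) => [r| |]//=; rewrite ?normr0 ?leey.
apply: ae_eq_integral => //.
by apply: filterS (integrable_ae measurableT iG) => x /= h /h /fineK.
Qed.

Let iG1 : m1.-integrable setT G1.
Proof. exact: integrable_fubini_F. Qed.

Let iG2 : m2.-integrable setT G2.
Proof.
have mf := measurable_int _ fiT.
apply/integrableP; split; first exact: (measurable_fubini_G fiT).
have lty : (\int[m2]_y \int[m1]_x `|((EFin \o f) \_ (A `*` B)) (x, y)| < +oo)%E.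
  by apply/(integrable21ltyP m1 m2 mf).
apply: le_lt_trans lty.
apply: ge0_le_integral => //.
- by apply: measurableT_comp => //; exact: (measurable_fubini_G fiT).
- have maf : measurable_fun setT (abse \o ((EFin \o f) \_ (A `*` B))).
    exact: measurableT_comp.
  by have := measurable_fun_fubini_tonelli_G (m1 := m1) _ maf; apply => z; exact: abse_ge0.
- move=> y _; apply: le_abse_integral => //.
  exact: measurableT_comp.
Qed.

Lemma integrable_Rintegral2 :
  m2.-integrable B (EFin \o (fun y => \int[m1]_(x in A) f (x, y))).
Proof.
apply/(integrable_mkcond _ mB); rewrite patch2.
exact: (integrable_fine iG2).1.
Qed.

(** [energy] integrates the exterior variable first; the argument at a fixed exterior point needs it
    last. *)
Lemma Rintegral_fubini :
  \int[m1]_(x in A) (\int[m2]_(y in B) f (x, y)) =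
  \int[m2]_(y in B) (\int[m1]_(x in A) f (x, y)).
Proof.
rewrite /Rintegral; congr fine.
transitivity (\int[m1]_x G1 x)%E.
  by rewrite -(integrable_fine iG1).2 integral_mkcond; have := patch1; rewrite /comp => ->.
transitivity (\int[m2]_x G2 x)%E.
  by rewrite integral12_prod_meas1// integral21_prod_meas1.
by rewrite -(integrable_fine iG2).2 [RHS]integral_mkcond; have := patch2; rewrite /comp => ->.
Qed.

End fubini.

End fubini_set.

(** * Truncation decreases the form *)

Section outer_point.
Context {R : realType} {n : nat}.
Local Notation X := 'rV[R]_n.
Local Notation mu := (lebesgue n).
Variables (s : R) (Omega : set X).
Hypotheses (s0 : 0 < s) (mOmega : measurable Omega) (Omega_fin : (mu Omega < +oo)%E).
Local Notation K := (sing_kernel s).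

Lemma Lp2_cst1 : Lp Omega 2 (cst 1 : X -> R).
Proof.
apply/(Lp2P mOmega); split; first exact: measurable_cst.
under eq_integral do rewrite /= expr1n.
by rewrite integral_cst// mul1e.
Qed.

Section fixed_point.
Variable x : X.
Hypothesis xO : ~ closure Omega x.

Lemma integrable_mul_kernel (f : X -> R) : mu.-integrable Omega (EFin \o f) ->
  mu.-integrable Omega (EFin \o (fun y => f y * K x y)).
Proof.
move=> fi; have [C KC] := sing_kernel_bounded s0 xO.
have mf : measurable_fun Omega f by apply/measurable_EFinP; exact: measurable_int fi.
have mK : measurable_fun Omega (K x).
  by apply: measurable_funTS; exact: measurable_sing_kernel.
apply: (le_integrable mOmega _ _ (integrableZl mOmega C fi)).
  by apply/measurable_EFinP; exact: measurable_funM.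
move=> y Oy /=; rewrite lee_fin !normrM mulrC ler_wpM2r//.
by rewrite ger0_norm ?sing_kernel_ge0// (le_trans (KC _ Oy))// ler_norm.
Qed.

Let I f := \int[mu]_(y in Omega) (f y * K x y).

Let I_ge0 f : (forall y, Omega y -> 0 <= f y) -> 0 <= I f.
Proof.
by move=> f0; apply: Rintegral_ge0 => y Oy; rewrite mulr_ge0 ?sing_kernel_ge0// f0.
Qed.

Let I_lin a b f g h : mu.-integrable Omega (EFin \o f) ->
  mu.-integrable Omega (EFin \o g) -> mu.-integrable Omega (EFin \o h) ->
  I (fun y => f y + a * g y + b * h y) = I f + a * I g + b * I h.
Proof.
move=> /integrable_mul_kernel fi /integrable_mul_kernel gi /integrable_mul_kernel hi.
rewrite /I -!RintegralZl//.
have agi := integrableZl mOmega a gi; have bhi := integrableZl mOmega b hi.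
rewrite -RintegralD// -RintegralD//; last exact: (integrableD mOmega fi agi).
by apply: eq_Rintegral => y _; rewrite !mulrDl !mulrA.
Qed.

Variables (c b U V : R) (u : X -> R).
Hypotheses (c0 : 0 <= c) (b0 : 0 <= b) (u2 : Lp Omega 2 u).
Local Notation P := (trunc c).
(** Euler-Lagrange equation of a |-> int (a - u y)^2 K x y dy + b a^2. It characterizes the Neumann
    value for b = 0 and the Robin value for b = beta / [Cns], where the denominators do not
    vanish. *)
Hypothesis balanceU :
  (rho s Omega x + b) * U = \int[mu]_(y in Omega) (u y * K x y).
Hypothesis balanceV :
  (rho s Omega x + b) * V = \int[mu]_(y in Omega) (P (u y) * K x y).

Let i1 : mu.-integrable Omega (EFin \o (cst 1 : X -> R)).
Proof.
have := L2inner_integrable mOmega Lp2_cst1 Lp2_cst1.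
by under eq_fun do rewrite mulr1.
Qed.

Let ilin (v : X -> R) : Lp Omega 2 v -> mu.-integrable Omega (EFin \o v).
Proof.
move=> v2; have := L2inner_integrable mOmega v2 Lp2_cst1.
by rewrite (_ : (fun y => v y * cst 1 y) = v)//; apply/funext => y; rewrite mulr1.
Qed.

Let Pu2 : Lp Omega 2 (P \o u) := Lp2_trunc mOmega c0 u2.

Let iM v w : Lp Omega 2 v -> Lp Omega 2 w ->
  mu.-integrable Omega (EFin \o (fun y => v y * w y)).
Proof. exact: L2inner_integrable. Qed.

Let I1 : I (cst 1) = rho s Omega x.
Proof. by apply: eq_Rintegral => y _; rewrite mul1r. Qed.

Let shift2 (v : X -> R) a : Lp Omega 2 v -> Lp Omega 2 (fun y => a - v y).
Proof.
move=> v2; have := Lp2D (Lp2Z a Lp2_cst1) (Lp2Z (-1) v2).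
rewrite (_ : _ \+ _ = (fun y => a - v y))//.
by apply/funext => y /=; rewrite scaleN1r [a *: 1]mulr1.
Qed.

(* [V] minimizes [a |-> int (a - P (u y))^2 K x y dy + b a^2], so it does at
   least as well as [P U]; then [P] is 1-Lipschitz and [`|P U| <= `|U|]. *)
Lemma outer_energy_le :
  (\int[mu]_(y in Omega) ((V - P (u y)) ^+ 2 * K x y)%:E + (V ^+ 2 * `|b|)%:E <=
   \int[mu]_(y in Omega) ((U - u y) ^+ 2 * K x y)%:E + (U ^+ 2 * `|b|)%:E)%E.
Proof.
have E (v : X -> R) a : Lp Omega 2 v ->
    (\int[mu]_(y in Omega) ((a - v y) ^+ 2 * K x y)%:E)%E = (I (fun y => (a - v y) ^+ 2))%:E.
  move=> v2; rewrite /I /Rintegral fineK//.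
  apply: integrable_fin_num => //.
  apply: (@integrable_mul_kernel (fun y => (a - v y) ^+ 2)).
  exact: iM (shift2 a v2) (shift2 a v2).
rewrite (E _ _ Pu2) E// -!EFinD lee_fin (ger0_norm b0) => {E}.
pose a := P U.
(* With p = P (u y), (V - p)^2 = (a - p)^2 + (V^2 - a^2) + 2 (a - V) p. Once the penalties are
   added, the balance for [V] leaves the value at [a] minus (rho + b) (a - V)^2. *)
have h1 : I (fun y => (V - P (u y)) ^+ 2) =
    I (fun y => (a - P (u y)) ^+ 2) + (V ^+ 2 - a ^+ 2) * rho s Omega x +
      2 * (a - V) * ((rho s Omega x + b) * V).
  rewrite balanceV -I1 -I_lin//.
  - by apply: eq_Rintegral => y _ /=; congr (_ * _); ring.
  - exact: iM (shift2 a Pu2) (shift2 a Pu2).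
  - exact: ilin.
have h2 : I (fun y => (a - P (u y)) ^+ 2) <= I (fun y => (U - u y) ^+ 2).
  apply: le_Rintegral => //.
  - exact: (integrable_mul_kernel (iM (shift2 a Pu2) (shift2 a Pu2))).
  - exact: (integrable_mul_kernel (iM (shift2 U u2) (shift2 U u2))).
  - move=> y _; rewrite ler_wpM2r ?sing_kernel_ge0//.
    rewrite -[leLHS]real_normK ?num_real// -[leRHS]real_normK ?num_real//.
    by rewrite ler_sqr ?nnegrE// trunc_lip.
have h3 : a ^+ 2 <= U ^+ 2.
  rewrite -[leLHS]real_normK ?num_real// -[leRHS]real_normK ?num_real//.
  by rewrite ler_sqr ?nnegrE// trunc_norm.
have r0 : 0 <= rho s Omega x by rewrite -I1; apply: I_ge0 => y _ /=.
have h4 : 0 <= (rho s Omega x + b) * (a - V) ^+ 2 by rewrite mulr_ge0 ?addr_ge0// sqr_ge0.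
have h5 : b * a ^+ 2 <= b * U ^+ 2 by rewrite ler_wpM2l.
rewrite h1; nra.
Qed.

(* Replacing [V] by [P U] in the integral costs [b U (P U - V)], by the balance
   equation for [U]; what remains is nonnegative because [P] is nondecreasing. *)
Lemma outer_form_ge0 :
  0 <= \int[mu]_(y in Omega) ((U - u y) * (V - P (u y)) * K x y) + b * U * V.
Proof.
pose a := P U.
have -> : \int[mu]_(y in Omega) ((U - u y) * (V - P (u y)) * K x y) =
    I (fun y => (U - u y) * (a - P (u y))) + (U * (V - a)) * rho s Omega x +
      (a - V) * ((rho s Omega x + b) * U).
  rewrite balanceU -I1 -I_lin//.
  - by apply: eq_Rintegral => y _ /=; congr (_ * _); ring.
  - exact: iM (shift2 U u2) (shift2 a Pu2).
  - exact: ilin.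
have h1 : 0 <= I (fun y => (U - u y) * (a - P (u y))).
  by apply: I_ge0 => y _; exact: trunc_mono.
have h2 : 0 <= b * (U * a) by rewrite mulr_ge0// trunc_mul_ge0.
nra.
Qed.

End fixed_point.

End outer_point.

(** * Comparison of two functions through their energies at exterior points *)

Section energy_comparison.
Context {R : realType} {n : nat}.
Local Notation X := 'rV[R]_n.
Local Notation mu := (lebesgue n).
Variables (s : R) (Omega : set X).
Hypothesis mOmega : measurable Omega.
Local Notation K := (sing_kernel s).
Local Notation O' := (~` Omega).

Definition energy_density (u : X -> R) (z : X * X) : \bar R :=
  ((u z.1 - u z.2) ^+ 2 * K z.1 z.2)%:E.
Local Notation D := energy_density.

Lemma energy_density_ge0 u z : (0 <= D u z)%E.
Proof. by rewrite lee_fin mulr_ge0 ?sqr_ge0 ?sing_kernel_ge0. Qed.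
Hint Resolve energy_density_ge0 : core.

Lemma energy_densityC u x y : D u (x, y) = D u (y, x).
Proof. by rewrite /D /= sing_kernelC -[in LHS]sqrrN opprB. Qed.

Lemma measurable_kernel_pair : measurable_fun setT (fun z : X * X => K z.1 z.2).
Proof. exact: measurable_sing_kernel. Qed.

Lemma measurable_fst_comp (u : X -> R) : measurable_fun setT u ->
  measurable_fun setT (fun z : X * X => u z.1).
Proof. by move=> mu_; exact: measurableT_comp mu_ measurable_fst. Qed.

Lemma measurable_snd_comp (u : X -> R) : measurable_fun setT u ->
  measurable_fun setT (fun z : X * X => u z.2).
Proof. by move=> mu_; exact: measurableT_comp mu_ measurable_snd. Qed.

Lemma measurable_diff_pair (u : X -> R) : measurable_fun setT u ->
  measurable_fun setT (fun z : X * X => u z.1 - u z.2).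
Proof.
by move=> mu_; apply: measurable_funB; [exact: measurable_fst_comp|exact: measurable_snd_comp].
Qed.

Lemma measurable_energy_density u : measurable_fun setT u ->
  measurable_fun setT (D u).
Proof.
move=> mu_; apply/measurable_EFinP; apply: measurable_funM.
  by apply: measurable_funX; exact: measurable_diff_pair.
exact: measurable_kernel_pair.
Qed.

Let mO' : measurable O'. Proof. exact: measurableC. Qed.

Let mcross : measurable (~` (O' `*` O')).
Proof. by apply: measurableC; exact: measurableX. Qed.

Lemma cross_partition :
  ~` (O' `*` O') = (Omega `*` Omega) `|` ((Omega `*` O') `|` (O' `*` Omega)).
Proof.
apply/seteqP; split => [[x y] /= h|[x y] /=].
  have [xO|xO] := pselect (Omega x); have [yO|yO] := pselect (Omega y).
  - by left.
  - by right; left.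
  - by right; right.
  - by exfalso; apply: h.
by move=> [[xO yO] []|[[xO yO] []|[xO yO] []]].
Qed.

Lemma W_energy_lty b u : W s Omega b u <->
  [/\ measurable_fun setT u, (\int[mu]_(x in Omega) (u x ^+ 2)%:E < +oo)%E,
    (\int[mu]_(x in O') (u x ^+ 2 * `|b x|)%:E < +oo)%E &
    (\int[mu \x mu]_(z in ~` (O' `*` O')) D u z < +oo)%E].
Proof.
rewrite /W.
under [X in (X + _ + _)%E]eq_integral do rewrite real_normK ?num_real//.
under [X in (_ + X + _)%E]eq_integral do rewrite real_normK ?num_real//.
under [X in (_ + _ + X)%E]eq_integral do rewrite real_normK ?num_real//.
have i1 : (0 <= \int[mu]_(x in Omega) (u x ^+ 2)%:E)%E.
  by apply: integral_ge0 => x _; rewrite lee_fin sqr_ge0.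
have i2 : (0 <= \int[mu]_(x in O') (u x ^+ 2 * `|b x|)%:E)%E.
  by apply: integral_ge0 => x _; rewrite lee_fin mulr_ge0 ?sqr_ge0.
have i3 : (0 <= \int[mu \x mu]_(z in ~` (O' `*` O')) D u z)%E.
  exact: integral_ge0.
split=> [[mu_ h]|[mu_ h1 h2 h3]]; split=> //.
- by rewrite (le_lt_trans _ h)// -addeA leeDl// adde_ge0.
- by rewrite (le_lt_trans _ h)// addeAC leeDr// adde_ge0.
- by rewrite (le_lt_trans _ h)// leeDr// adde_ge0.
- by apply: lte_add_pinfty => //; exact: lte_add_pinfty.
Qed.

Variables U V b : X -> R.
Hypothesis mb : measurable_fun O' b.
Hypothesis mV : measurable_fun setT V.
Hypothesis WU : W s Omega b U.
Hypothesis VU : forall x, Omega x -> `|V x| <= `|U x|.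
Hypothesis VVUU : forall x y, Omega x -> Omega y -> `|V x - V y| <= `|U x - U y|.
Hypothesis VU_mono : forall x y, Omega x -> Omega y ->
  0 <= (U x - U y) * (V x - V y).
(** The substitute, at exterior points, for a pointwise contraction property of [V] with respect to
    [U]. *)
Hypothesis V_outer : \forall x \ae mu, O' x ->
  (\int[mu]_(y in Omega) D V (x, y) + (V x ^+ 2 * `|b x|)%:E <=
   \int[mu]_(y in Omega) D U (x, y) + (U x ^+ 2 * `|b x|)%:E)%E.

Let mU : measurable_fun setT U. Proof. by case: WU. Qed.

Let U1 : (\int[mu]_(x in Omega) (U x ^+ 2)%:E < +oo)%E.
Proof. by have /W_energy_lty[] := WU. Qed.

Let U2 : (\int[mu]_(x in O') (U x ^+ 2 * `|b x|)%:E < +oo)%E.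
Proof. by have /W_energy_lty[] := WU. Qed.

Let U3 A : measurable A -> A `<=` ~` (O' `*` O') ->
  (\int[mu \x mu]_(z in A) D U z < +oo)%E.
Proof.
move=> mA AC; have /W_energy_lty[_ _ _ h] := WU.
rewrite (le_lt_trans _ h)//; apply: ge0_subset_integral => //.
by apply: measurable_funTS; exact: measurable_energy_density.
Qed.

Let mb2 (u : X -> R) : measurable_fun setT u ->
  measurable_fun O' (fun x => (u x ^+ 2 * `|b x|)%:E).
Proof.
move=> mu_; apply/measurable_EFinP; apply: measurable_funM.
  by apply: measurable_funX; exact: measurable_funTS.
exact: measurableT_comp.
Qed.

Let mF (u : X -> R) : measurable_fun setT u ->
  measurable_fun O' (fun x => \int[mu]_(y in Omega) D u (x, y))%E.
Proof.
by move=> mu_; apply: measurable_tonelli_set1 => //; exact: measurable_energy_density.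
Qed.

Let F0 (u : X -> R) x : (0 <= \int[mu]_(y in Omega) D u (x, y))%E.
Proof. exact: integral_ge0. Qed.

Let outer_lty :
  (\int[mu]_(x in O') (\int[mu]_(y in Omega) D V (x, y) + (V x ^+ 2 * `|b x|)%:E) < +oo)%E.
Proof.
have b0 (u : X -> R) x : (0 <= (u x ^+ 2 * `|b x|)%:E)%E.
  by rewrite lee_fin mulr_ge0 ?sqr_ge0.
apply: (@le_lt_trans _ _ (\int[mu]_(x in O')
    (\int[mu]_(y in Omega) D U (x, y) + (U x ^+ 2 * `|b x|)%:E))%E).
  apply: ae_ge0_le_integral => //.
  - by move=> x _; rewrite adde_ge0.
  - by apply: emeasurable_funD; [exact: mF|exact: mb2].
  - by move=> x _; rewrite adde_ge0.
  - by apply: emeasurable_funD; [exact: mF|exact: mb2].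
rewrite ge0_integralD//; [|exact: mF|exact: mb2].
apply: lte_add_pinfty => //.
rewrite -(@tonelli_set1 _ _ _ _ _ mu mu O' Omega)//; last exact: measurable_energy_density.
apply: U3; first exact: measurableX.
by rewrite cross_partition => z ?; right; right.
Qed.

Let V_outer_lty : (\int[mu \x mu]_(z in O' `*` Omega) D V z < +oo)%E.
Proof.
rewrite tonelli_set1//; last exact: measurable_energy_density.
rewrite (le_lt_trans _ outer_lty)//; apply: ge0_le_integral => //.
- exact: mF.
- by apply: emeasurable_funD; [exact: mF|exact: mb2].
- by move=> x _; rewrite leeDl// lee_fin mulr_ge0 ?sqr_ge0.
Qed.

(** The two mixed rectangles are mirror images, the density is symmetric, and Tonelli applies in
    both orders. *)
Let V_outer_lty' : (\int[mu \x mu]_(z in Omega `*` O') D V z < +oo)%E.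
Proof.
rewrite (le_lt_trans _ V_outer_lty)// le_eqVlt; apply/orP; left; apply/eqP.
rewrite [LHS](tonelli_set1 mu mu mOmega mO' (measurable_energy_density mV) (energy_density_ge0 V)).
rewrite [RHS](tonelli_set2 mu mu mO' mOmega (measurable_energy_density mV) (energy_density_ge0 V)).
apply: eq_integral => x _; apply: eq_integral => y _.
exact: energy_densityC.
Qed.

(** On [Omega] x [Omega] the density of [V] is pointwise below that of [U]; the mixed rectangles and
    the weighted term are controlled together by [V_outer]. *)
Lemma W_comparison : W s Omega b V.
Proof.
apply/W_energy_lty; split => //.
- rewrite (le_lt_trans _ U1)//; apply: ge0_le_integral => //.
  + by move=> x _; rewrite lee_fin sqr_ge0.
  + by apply/measurable_EFinP; apply: measurable_funX; exact: measurable_funTS.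
  + by apply/measurable_EFinP; apply: measurable_funX; exact: measurable_funTS.
  + move=> x /VU h; rewrite lee_fin -[leLHS]real_normK ?num_real//.
    by rewrite -[leRHS]real_normK ?num_real// ler_sqr ?nnegrE.
- rewrite (le_lt_trans _ outer_lty)//; apply: ge0_le_integral => //.
  + by move=> x _; rewrite lee_fin mulr_ge0 ?sqr_ge0.
  + exact: mb2.
  + by apply: emeasurable_funD; [exact: mF|exact: mb2].
  + by move=> x _; rewrite leeDr.
- have mDV A : measurable_fun A (D V).
    by apply: measurable_funTS; exact: measurable_energy_density.
  have mOO' := measurableX mOmega mO'; have mO'O := measurableX mO' mOmega.
  have mOO := measurableX mOmega mOmega.
  rewrite cross_partition ge0_integral_setU//; first last.
  + apply/disj_setPS => -[x y] /= [[xO yO] [[_ yO']|[xO' _]]] => //.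
  + exact: measurableU.
  rewrite ge0_integral_setU//; last first.
    by apply/disj_setPS => -[x y] /= [[xO yO] [xO' _]].
  apply: lte_add_pinfty; last exact: lte_add_pinfty.
  apply: (@le_lt_trans _ _ (\int[mu \x mu]_(z in Omega `*` Omega) D U z)%E); last first.
    by apply: U3 => //; rewrite cross_partition => z ?; left.
  apply: ge0_le_integral => //.
  + by apply: measurable_funTS; exact: measurable_energy_density.
  + move=> [x y] [/= xO yO]; rewrite lee_fin ler_wpM2r ?sing_kernel_ge0//=.
    rewrite -[leLHS]real_normK ?num_real// -[leRHS]real_normK ?num_real//.
    by rewrite ler_sqr ?nnegrE// VVUU.
Qed.

Hypothesis V_outer_form : \forall x \ae mu, O' x ->
  0 <= \int[mu]_(y in Omega) ((U x - U y) * (V x - V y) * K x y) + b x * U x * V x.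

Let g (z : X * X) := (U z.1 - U z.2) * (V z.1 - V z.2) * K z.1 z.2.

Let gC x y : g (y, x) = (U x - U y) * (V x - V y) * K x y.
Proof. by rewrite /g /= sing_kernelC; congr (_ * _); rewrite -[LHS]mulrNN !opprB. Qed.

Lemma normM_le_sqr (x y : R) : `|x * y| <= x ^+ 2 + y ^+ 2.
Proof.
have h1 := sqr_ge0 (x + y); have h2 := sqr_ge0 (x - y).
by rewrite ler_norml; apply/andP; split; nra.
Qed.

(** Needed to swap a signed integral: |g| is at most D U + D V, and both are finite on the mixed
    rectangle. *)
Let ig : (mu \x mu)%E.-integrable (Omega `*` O') (EFin \o g).
Proof.
have mOO' := measurableX mOmega mO'.
have sub : Omega `*` O' `<=` ~` (O' `*` O').
  by rewrite cross_partition => z ?; right; left.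
have mD u : measurable_fun setT u -> measurable_fun (Omega `*` O') (D u).
  by move=> mu_; apply: measurable_funTS; exact: measurable_energy_density.
apply/integrableP; split.
  apply/measurable_EFinP; apply: measurable_funTS.
  apply: measurable_funM; last exact: measurable_kernel_pair.
  by apply: measurable_funM; exact: measurable_diff_pair.
apply: (@le_lt_trans _ _ (\int[mu \x mu]_(z in Omega `*` O') (D U z + D V z))%E).
  apply: ge0_le_integral => //.
  - apply: measurableT_comp => //; apply/measurable_EFinP; apply: measurable_funTS.
    apply: measurable_funM; last exact: measurable_kernel_pair.
    by apply: measurable_funM; exact: measurable_diff_pair.
  - by apply: emeasurable_funD; exact: mD.
  - move=> z _; rewrite /D -EFinD -mulrDl lee_fin normrM.
    rewrite [X in _ * X]ger0_norm ?sing_kernel_ge0//.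
    by rewrite ler_wpM2r ?sing_kernel_ge0// normM_le_sqr.
rewrite ge0_integralD//; [|exact: mD|exact: mD].
by apply: lte_add_pinfty; [exact: U3|exact: V_outer_lty'].
Qed.

Let ib : mu.-integrable O' (EFin \o (fun x => b x * U x * V x)).
Proof.
have /W_energy_lty[_ _ V2 _] := W_comparison.
apply/integrableP; split.
  apply/measurable_EFinP; apply: measurable_funM; last exact: measurable_funTS.
  by apply: measurable_funM => //; exact: measurable_funTS.
apply: (@le_lt_trans _ _ (\int[mu]_(x in O') ((U x ^+ 2 * `|b x|)%:E + (V x ^+ 2 * `|b x|)%:E))%E).
  apply: ge0_le_integral => //.
  - apply: measurableT_comp => //; apply/measurable_EFinP.
    apply: measurable_funM; last exact: measurable_funTS.
    by apply: measurable_funM => //; exact: measurable_funTS.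
  - by apply: emeasurable_funD; exact: mb2.
  - move=> x _; rewrite -EFinD -mulrDl lee_fin -mulrA normrM mulrC.
    by rewrite ler_wpM2r// normM_le_sqr.
rewrite ge0_integralD//; first exact: lte_add_pinfty.
- by move=> x _; rewrite lee_fin mulr_ge0 ?sqr_ge0.
- exact: mb2.
- by move=> x _; rewrite lee_fin mulr_ge0 ?sqr_ge0.
- exact: mb2.
Qed.

Lemma Gamma_ge0 (z : R) : 0 <= Gamma z.
Proof. by apply: Rintegral_ge0 => t _; rewrite mulr_ge0 ?powR_ge0 ?expR_ge0. Qed.

Lemma Cns_ge0 : 0 < s -> 0 <= Cns (n := n) s.
Proof.
move=> s0; rewrite /Cns divr_ge0// mulr_ge0 ?Gamma_ge0 ?powR_ge0//.
by rewrite mulr_ge0 ?powR_ge0// ltW.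
Qed.

Lemma ae_Rintegral_ge0 (A : set X) (f : X -> R) : measurable A ->
  mu.-integrable A (EFin \o f) -> (\forall x \ae mu, A x -> 0 <= f x) ->
  0 <= \int[mu]_(x in A) f x.
Proof.
move=> mA fi f0.
have mf := measurable_int _ fi.
rewrite /Rintegral (@ae_eq_integral _ _ _ mu A (fun x => (`|f x|)%:E))//.
- by apply: fine_ge0; apply: integral_ge0.
- by apply: (measurableT_comp (@abse_measurable R setT)) mf.
- by apply: filterS f0 => x h xA; rewrite ger0_norm// h.
Qed.

(** The interior part is nonnegative by [VU_mono]. After the swap, the mixed part and the penalty,
    both with factor [Cns], form one integral over exterior points with the integrand of
    [V_outer_form]. *)
Lemma form_comparison : 0 < s ->
  0 <= energy s Omega U V + \int[mu]_(x in O') (Cns (n := n) s * (b x * U x * V x)).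
Proof.
move=> s0; have C0 := Cns_ge0 s0.
rewrite RintegralZl// /energy -addrA addr_ge0//.
  apply: mulr_ge0; first by apply: mulr_ge0 => //; rewrite invr_ge0.
  apply: Rintegral_ge0 => x xO.
  apply: Rintegral_ge0 => y yO.
  by rewrite mulr_ge0 ?sing_kernel_ge0// VU_mono.
rewrite -mulrDr mulr_ge0//.
rewrite (Rintegral_fubini mOmega mO' ig) -RintegralD//; last first.
  exact: (integrable_Rintegral2 mOmega mO' ig).
apply: (ae_Rintegral_ge0 mO').
  exact: (integrableD mO' (integrable_Rintegral2 mOmega mO' ig) ib).
have gE x : \int[mu]_(y in Omega) g (y, x) =
    \int[mu]_(y in Omega) ((U x - U y) * (V x - V y) * K x y).
  by apply: eq_Rintegral => y _; exact: gC.
by apply: filterS V_outer_form => x h xO; rewrite gE h.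
Qed.

End energy_comparison.

(** * One shape for the Dirichlet, Neumann and Robin extensions *)

Section kernel_extension.
Context {R : realType} {n : nat}.
Local Notation X := 'rV[R]_n.
Local Notation mu := (lebesgue n).
Variables (s : R) (Omega : set X).
Hypotheses (s0 : 0 < s) (mOmega : measurable Omega) (Omega_fin : (mu Omega < +oo)%E).
Local Notation K := (sing_kernel s).
Local Notation O' := (~` Omega).

(** For v >= 0 Tonelli gives measurability at all x, including those where the integral is infinite.
    It serves for the constant 1 and for P u; the extension of u itself is measurable by [W]. *)
Lemma measurable_kernel_integral (v : X -> R) : measurable_fun Omega v ->
  (forall y, Omega y -> 0 <= v y) ->
  measurable_fun setT (fun x => \int[mu]_(y in Omega) (v y * K x y)).
Proof.
move=> mv v0.
pose f (z : X * X) := ((v \_ Omega) z.2 * K z.1 z.2)%:E.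
have mf : measurable_fun setT f.
  apply/measurable_EFinP; apply: measurable_funM; last exact: measurable_kernel_pair.
  by apply: measurable_snd_comp; exact/(measurable_restrictT _ mOmega).
have f0 z : (0 <= f z)%E.
  rewrite lee_fin mulr_ge0 ?sing_kernel_ge0// patchE.
  by case: ifPn => // /set_mem/v0.
rewrite (_ : (fun x => _) = fine \o fubini_F mu f).
  have mF := measurable_fun_fubini_tonelli_F (m2 := mu) _ mf f0.
  exact: measurableT_comp (@fine_measurable R setT measurableT) mF.
apply/funext => x; rewrite /fubini_F /= /Rintegral; congr fine.
rewrite integral_mkcond; apply: eq_integral => y _.
by rewrite /f /= !patchE; case: ifP => //; rewrite mul0r.
Qed.

Lemma measurable_rho : measurable_fun setT (rho s Omega).
Proof.
have := @measurable_kernel_integral (cst 1) (measurable_cst _) (fun _ _ => ler01).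
by congr measurable_fun; apply/funext => x; apply: eq_Rintegral => y _; rewrite /= mul1r.
Qed.

(* Off the closure of [Omega], [m] is [0] for the Dirichlet extension, [1 / rho]
   for the Neumann one and [Cns / (Cns * rho + beta)] for the Robin one; [b] is
   [0], [0] and [beta / Cns]. *)
Variables m b : X -> R.
Hypothesis mm : measurable_fun setT m.
Hypothesis mb : measurable_fun O' b.
Hypothesis mbP : \forall x \ae mu, O' x -> 0 <= b x /\
  (m x = 0 \/ ~ closure Omega x /\ m x * (rho s Omega x + b x) = 1).

Definition kernel_ext (u : X -> R) x : R :=
  if x \in Omega then u x else m x * \int[mu]_(y in Omega) (u y * K x y).

Lemma kernel_ext_in u x : Omega x -> kernel_ext u x = u x.
Proof. by move=> xO; rewrite /kernel_ext mem_set. Qed.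

Lemma kernel_ext_out u x : O' x ->
  kernel_ext u x = m x * \int[mu]_(y in Omega) (u y * K x y).
Proof. by move=> xO; rewrite /kernel_ext memNset. Qed.

Lemma measurable_kernel_ext (u : X -> R) : measurable_fun Omega u ->
  (forall y, Omega y -> 0 <= u y) -> measurable_fun setT (kernel_ext u).
Proof.
move=> mu_ u0.
rewrite (_ : kernel_ext u = (u \_ Omega) \+
    ((fun x => m x * \int[mu]_(y in Omega) (u y * K x y)) \_ O')).
  apply: measurable_funD; first exact/(measurable_restrictT _ mOmega).
  apply/(measurable_restrictT _ (measurableC mOmega)); apply: measurable_funTS.
  by apply: measurable_funM => //; exact: measurable_kernel_integral.
apply/funext => x /=; rewrite !patchE /kernel_ext in_setC.
by case: ifP => _ /=; rewrite ?addr0 ?add0r.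
Qed.

Section trunc_ext.
Variables (c : R) (u : X -> R).
Hypotheses (c0 : 0 <= c) (u2 : Lp Omega 2 u).
Hypothesis WU : W s Omega b (kernel_ext u).
Local Notation U := (kernel_ext u).
Local Notation V := (kernel_ext (trunc c \o u)).

Let mu_ : measurable_fun Omega u.
Proof. by have /(Lp2P mOmega)[] := u2. Qed.

Let mPu : measurable_fun Omega (trunc c \o u).
Proof. exact: measurableT_comp (measurable_trunc c) mu_. Qed.

Let mV : measurable_fun setT V.
Proof. by apply: measurable_kernel_ext => // y _; exact: trunc_ge0. Qed.

Let VU x : Omega x -> `|V x| <= `|U x|.
Proof. by move=> xO; rewrite !kernel_ext_in//; exact: trunc_norm. Qed.

Let VVUU x y : Omega x -> Omega y -> `|V x - V y| <= `|U x - U y|.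
Proof. by move=> xO yO; rewrite !kernel_ext_in//; exact: trunc_lip. Qed.

Let VU_mono x y : Omega x -> Omega y -> 0 <= (U x - U y) * (V x - V y).
Proof. by move=> xO yO; rewrite !kernel_ext_in//; exact: trunc_mono. Qed.

Let balance v x : O' x -> m x * (rho s Omega x + b x) = 1 ->
  (rho s Omega x + b x) * kernel_ext v x = \int[mu]_(y in Omega) (v y * K x y).
Proof. by move=> xO mx; rewrite kernel_ext_out// mulrA [_ * m x]mulrC mx mul1r. Qed.

Let V_outer : \forall x \ae mu, O' x ->
  (\int[mu]_(y in Omega) energy_density s V (x, y) + (V x ^+ 2 * `|b x|)%:E <=
   \int[mu]_(y in Omega) energy_density s U (x, y) + (U x ^+ 2 * `|b x|)%:E)%E.
Proof.
apply: filterS mbP => x mbx xO; have [b0 hm] := mbx xO.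
rewrite (_ : \int[mu]_(y in Omega) energy_density s V (x, y) =
  \int[mu]_(y in Omega) ((V x - trunc c (u y)) ^+ 2 * K x y)%:E)%E; last first.
  by apply: eq_integral => y /set_mem yO; rewrite /energy_density /= (kernel_ext_in _ yO).
rewrite (_ : \int[mu]_(y in Omega) energy_density s U (x, y) =
  \int[mu]_(y in Omega) ((U x - u y) ^+ 2 * K x y)%:E)%E; last first.
  by apply: eq_integral => y /set_mem yO; rewrite /energy_density /= (kernel_ext_in _ yO).
case: hm => [m0|[xcl mx]]; last first.
  by apply: outer_energy_le => //; exact: balance.
(* Where the multiplier vanishes both extensions are 0, and |P u| <= |u| on [Omega] is enough. *)
have -> : U x = 0 by rewrite kernel_ext_out// m0 mul0r.
have -> : V x = 0 by rewrite kernel_ext_out// m0 mul0r.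
rewrite leeD2r//.
have mK : measurable_fun Omega (K x).
  by apply: measurable_funTS; exact: measurable_sing_kernel.
apply: ge0_le_integral => //.
- by move=> y _; rewrite lee_fin mulr_ge0 ?sqr_ge0 ?sing_kernel_ge0.
- apply/measurable_EFinP; apply: measurable_funM => //; apply: measurable_funX.
  exact: measurable_funB.
- apply/measurable_EFinP; apply: measurable_funM => //; apply: measurable_funX.
  exact: measurable_funB.
- move=> y yO; rewrite lee_fin ler_wpM2r ?sing_kernel_ge0//.
  rewrite !sub0r !sqrrN -[leLHS]real_normK ?num_real// -[leRHS]real_normK ?num_real//.
  by rewrite ler_sqr ?nnegrE// trunc_norm.
Qed.

Let V_outer_form : \forall x \ae mu, O' x ->
  0 <= \int[mu]_(y in Omega) ((U x - U y) * (V x - V y) * K x y) + b x * U x * V x.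
Proof.
apply: filterS mbP => x mbx xO; have [b0 hm] := mbx xO.
rewrite (_ : \int[mu]_(y in Omega) ((U x - U y) * (V x - V y) * K x y) =
  \int[mu]_(y in Omega) ((U x - u y) * (V x - trunc c (u y)) * K x y)); last first.
  by apply: eq_Rintegral => y /set_mem yO; rewrite !(kernel_ext_in _ yO).
case: hm => [m0|[xcl mx]]; last first.
  by apply: outer_form_ge0 => //; exact: balance.
have -> : U x = 0 by rewrite kernel_ext_out// m0 mul0r.
have -> : V x = 0 by rewrite kernel_ext_out// m0 mul0r.
rewrite !mulr0 addr0; apply: Rintegral_ge0 => y _.
by rewrite mulr_ge0 ?sing_kernel_ge0// !sub0r mulrNN trunc_mul_ge0.
Qed.

Lemma W_kernel_ext_trunc : W s Omega b V.
Proof. exact: (W_comparison mOmega mb mV WU VU VVUU V_outer). Qed.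

Lemma form_kernel_ext_trunc_ge0 :
  0 <= energy s Omega U V +
    \int[mu]_(x in O') (Cns (n := n) s * (b x * U x * V x)).
Proof.
exact: (form_comparison mOmega mb mV WU VU VVUU VU_mono V_outer V_outer_form).
Qed.

End trunc_ext.

End kernel_extension.

(** The formula 1 / f = f (f^2)^(-1) reduces inversion to a real power of a nonnegative base, and it
    holds at zeros of f since 0^-1 = 0. *)
Lemma measurable_funV {R : realType} d (T : measurableType d) (f : T -> R) :
  measurable_fun setT f -> measurable_fun setT (fun x => (f x)^-1).
Proof.
move=> mf; rewrite (_ : (fun x => _) = (fun x => f x * (f x ^+ 2) `^ (-1))).
  apply: measurable_funM => //; apply: (measurableT_comp (measurable_powR _)).
  exact: measurable_funX.
apply/funext => x; rewrite powR_inv1 ?sqr_ge0//.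
have [->|fx0] := eqVneq (f x) 0; first by rewrite invr0 mul0r.
by rewrite expr2 invfM mulrA divff// mul1r.
Qed.

Lemma ge0_integral_scale_lty {R : realType} d (T : measurableType d)
    (m : {measure set T -> \bar R}) (D : set T) (f : T -> R) (k : R) :
  measurable D -> measurable_fun D f -> (forall x, D x -> 0 <= f x) -> 0 <= k ->
  (\int[m]_(x in D) (f x)%:E < +oo)%E -> (\int[m]_(x in D) (k * f x)%:E < +oo)%E.
Proof.
move=> mD mf f0 k0 fy; under eq_integral do rewrite EFinM.
rewrite ge0_integralZl_EFin//.
- by rewrite lte_mul_pinfty.
- exact/measurable_EFinP.
Qed.

(** * The Dirichlet, Neumann and Robin forms *)

Section submarkovian_forms.
Context {R : realType} {n : nat}.
Local Notation X := 'rV[R]_n.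
Local Notation mu := (lebesgue n).
Variables (s : R) (Omega : set X).
Hypotheses (s0 : 0 < s) (mOmega : measurable Omega) (Omega_fin : (mu Omega < +oo)%E).
Local Notation O' := (~` Omega).

(** The generator maps u to g exactly when the form operator maps u to - g; the test function P u
    then gives (P u, g) = - a(u, P u). *)
Lemma form_semigroup_submarkovian (D : set (X -> R))
    (a : (X -> R) -> (X -> R) -> R) (T : R -> (X -> R) -> X -> R) :
  (forall c u, 0 <= c -> D u -> D (trunc c \o u) /\ 0 <= a u (trunc c \o u)) ->
  form_semigroup Omega D a T -> submarkovian Omega T.
Proof.
move=> Da [C0 gen]; apply: (submarkovian_of_trunc_dissipative mOmega C0) => c u g c0 gug.
have [u2 g2 _] := gug; have /gen[Du _ au] := gug.
have [Dv a0] := Da c u c0 Du.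
rewrite -oppr_ge0 (le_trans a0)// au// -mulN1r.
rewrite -(L2innerZr mOmega (-1) (Lp2_trunc mOmega c0 u2) g2).
rewrite le_eqVlt; apply/orP; left; apply/eqP; apply: eq_Rintegral => x _ /=.
by rewrite scaleN1r mulrC.
Qed.

Lemma Rintegral_eq0 (A : set X) (f : X -> R) : (forall x, A x -> f x = 0) ->
  \int[mu]_(x in A) f x = 0.
Proof. by move=> f0; rewrite /Rintegral integral0_eq// => x /f0 ->. Qed.

Let mcl : measurable (closure Omega).
Proof. by apply: measurable_closed_rV; exact: closed_closure. Qed.

Let measurable_off_closure (f : X -> R) : measurable_fun setT f ->
  measurable_fun setT (fun x => if x \in closure Omega then 0 else f x).
Proof.
move=> mf; rewrite (_ : (fun x => _) = f \_ (~` closure Omega)).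
  by apply/(measurable_restrictT _ (measurableC mcl)); exact: measurable_funTS.
by apply/funext => x; rewrite patchE in_setC; case: ifP.
Qed.

Lemma kernel_ext_form_b0 (m : X -> R) (c : R) (u : X -> R) :
  measurable_fun setT m ->
  (forall x, O' x -> m x = 0 \/ ~ closure Omega x /\ m x * rho s Omega x = 1) ->
  0 <= c -> Lp Omega 2 u -> W s Omega (fun=> 0) (kernel_ext s Omega m u) ->
  (Lp Omega 2 (trunc c \o u) /\
    W s Omega (fun=> 0) (kernel_ext s Omega m (trunc c \o u))) /\
  0 <= energy s Omega (kernel_ext s Omega m u)
         (kernel_ext s Omega m (trunc c \o u)).
Proof.
move=> mm mP c0 u2 WU.
have mb : measurable_fun O' (fun=> 0 : R) by exact: measurable_cst.
have mbP : \forall x \ae mu, O' x -> 0 <= (0 : R) /\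
    (m x = 0 \/ ~ closure Omega x /\ m x * (rho s Omega x + 0) = 1).
  by apply: nearW => x /mP; rewrite addr0.
split; first split.
- exact: Lp2_trunc.
- exact: (W_kernel_ext_trunc s0 mOmega Omega_fin mm mb mbP c0 u2 WU).
have := form_kernel_ext_trunc_ge0 s0 mOmega Omega_fin mm mb mbP c0 u2 WU.
by rewrite [X in _ + X]Rintegral_eq0 ?addr0// => x _; rewrite !mul0r mulr0.
Qed.

Lemma trunc_dom_D c u : 0 <= c -> dom_D s Omega u ->
  dom_D s Omega (trunc c \o u) /\ 0 <= form_D s Omega u (trunc c \o u).
Proof.
move=> c0 [u2]; rewrite /dom_D /form_D.
have -> : ext_D Omega = kernel_ext s Omega (cst 0).
  by apply/funext => v; apply/funext => x; rewrite /ext_D /kernel_ext mul0r.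
by apply: kernel_ext_form_b0 => // x _; left.
Qed.

Lemma trunc_dom_N c u : 0 <= c -> dom_N s Omega u ->
  dom_N s Omega (trunc c \o u) /\ 0 <= form_N s Omega u (trunc c \o u).
Proof.
move=> c0 [u2]; rewrite /dom_N /form_N.
pose m x := if x \in closure Omega then 0 else (rho s Omega x)^-1.
have -> : ext_N s Omega = kernel_ext s Omega m.
  apply/funext => v; apply/funext => x; rewrite /ext_N /kernel_ext /m.
  by case: ifP => // _; case: ifP; rewrite ?mul0r ?div1r.
apply: kernel_ext_form_b0 => //.
  by apply: measurable_off_closure; apply: measurable_funV; exact: measurable_rho.
move=> x _; rewrite /m; case: ifPn => [_|/negP xcl]; first by left.
(* If rho vanishes, the convention 0^-1 = 0 makes the multiplier 0, the first alternative. *)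
have [r0|r0] := eqVneq (rho s Omega x) 0; first by left; rewrite r0 invr0.
by right; split; [move=> h; apply: xcl; exact: mem_set|rewrite mulVf].
Qed.

Variable beta : X -> R.
Hypothesis beta_int : mu.-integrable O' (EFin \o beta).
Hypothesis beta_ge0 : \forall x \ae mu, O' x -> 0 <= beta x.

Lemma trunc_dom_R c u : 0 <= c -> dom_R s Omega beta u ->
  dom_R s Omega beta (trunc c \o u) /\ 0 <= form_R s Omega beta u (trunc c \o u).
Proof.
move=> c0 [u2]; rewrite /dom_R /form_R.
pose C := Cns (n := n) s.
have C0 : 0 <= C := Cns_ge0 s0.
have mbeta : measurable_fun O' beta by apply/measurable_EFinP; exact: measurable_int beta_int.
(* [beta] is measurable only on the complement of [Omega]; cutting it off there makes [m] measurable
   everywhere and leaves the extension unchanged. *)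
pose m x := if x \in closure Omega then 0 else C / (C * rho s Omega x + (beta \_ O') x).
have -> : ext_R s Omega beta = kernel_ext s Omega m.
  apply/funext => v; apply/funext => x; rewrite /ext_R /kernel_ext /m.
  case: ifPn => // /negP xO; case: ifP => _; rewrite ?mul0r//.
  by rewrite patchE mem_set// => /mem_set.
(* [C > 0] is not needed: if [C] vanished, so would the extensions outside [Omega]. *)
pose b x := if C == 0 then 0 else beta x / C.
have mm : measurable_fun setT m.
  apply: measurable_off_closure; apply: measurable_funM => //.
  apply: measurable_funV; apply: measurable_funD.
    by apply: measurable_funM => //; exact: measurable_rho.
  exact/(measurable_restrictT _ (measurableC mOmega)).
have mb : measurable_fun O' b.
  rewrite /b; case: (C == 0); first exact: measurable_cst.
  by apply: measurable_funM => //; exact: measurable_cst.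
have mbP : \forall x \ae mu, O' x -> 0 <= b x /\
    (m x = 0 \/ ~ closure Omega x /\ m x * (rho s Omega x + b x) = 1).
  apply: filterS beta_ge0 => x bx xO; split.
    by rewrite /b; case: ifP => // _; rewrite divr_ge0// bx.
  rewrite /m; case: ifPn => [_|/negP xcl]; first by left.
  have [C00|C00] := eqVneq C 0; first by left; rewrite C00 mul0r.
  rewrite patchE mem_set//.
  have [d0|d0] := eqVneq (C * rho s Omega x + beta x) 0.
    by left; rewrite d0 invr0 mulr0.
  right; split; first by move=> h; apply: xcl; exact: mem_set.
  by rewrite /b (negbTE C00); field; rewrite C00.
have bC x : O' x -> forall v w, C * (b x * kernel_ext s Omega m v x * kernel_ext s Omega m w x) =
    beta x * kernel_ext s Omega m v x * kernel_ext s Omega m w x.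
  move=> xO v w; have [C00|C00] := eqVneq C 0.
    rewrite kernel_ext_out// /m; case: ifP => _; rewrite ?C00 !mul0r ?mulr0 ?mul0r//.
  by rewrite /b (negbTE C00); field.
move=> WU.
(* The two weights are proportional when C is nonzero; when C = 0 the extension vanishes outside
   [Omega] and both weighted terms are 0. *)
have Wb v : W s Omega beta (kernel_ext s Omega m v) <-> W s Omega b (kernel_ext s Omega m v).
  set w := kernel_ext s Omega m v.
  have w0 (f : X -> R) x : O' x -> 0 <= w x ^+ 2 * `|f x|.
    by move=> _; rewrite mulr_ge0 ?sqr_ge0.
  have mw (f : X -> R) : measurable_fun setT w -> measurable_fun O' f ->
      measurable_fun O' (fun x => w x ^+ 2 * `|f x|).
    move=> mw mf; apply: measurable_funM; last exact: measurableT_comp.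
    by apply: measurable_funX; exact: measurable_funTS.
  have bE x : O' x -> w x ^+ 2 * `|b x| = C^-1 * (w x ^+ 2 * `|beta x|) /\
      w x ^+ 2 * `|beta x| = C * (w x ^+ 2 * `|b x|).
    move=> xO; have [C00|C00] := eqVneq C 0.
      rewrite (_ : w x = 0) ?expr0n ?mul0r ?mulr0//.
      by rewrite /w kernel_ext_out// /m C00; case: ifP; rewrite ?mul0r.
    rewrite /b (negbTE C00) normrM normrV ?unitfE// (ger0_norm C0).
    by split; field.
  split=> /W_energy_lty[mu_ h1 h2 h3]; apply/W_energy_lty; split => //.
    rewrite (eq_integral (fun x => (C^-1 * (w x ^+ 2 * `|beta x|))%:E)).
      apply: ge0_integral_scale_lty => //; [exact: measurableC|exact: mw|exact: w0|].
      by rewrite invr_ge0.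
    by move=> x /set_mem/bE[->].
  rewrite (eq_integral (fun x => (C * (w x ^+ 2 * `|b x|))%:E)).
    by apply: ge0_integral_scale_lty => //; [exact: measurableC|exact: mw|exact: w0].
  by move=> x /set_mem/bE[_ ->].
have {}WU := (Wb u).1 WU.
split; first split.
- exact: Lp2_trunc.
- apply/Wb.
  exact: (W_kernel_ext_trunc s0 mOmega Omega_fin mm mb mbP c0 u2 WU).
have := form_kernel_ext_trunc_ge0 s0 mOmega Omega_fin mm mb mbP c0 u2 WU.
rewrite (@eq_Rintegral _ _ _ _ _ (fun x => beta x * kernel_ext s Omega m u x *
  kernel_ext s Omega m (trunc c \o u) x))//.
by move=> x /set_mem xO; exact: bC.
Qed.

End submarkovian_forms.

Theorem theorem4p4 (R : realType) (n : nat) (s : R) (Omega : set 'rV[R]_n)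
    (beta : 'rV[R]_n -> R) (T_D T_R T_N : R -> ('rV[R]_n -> R) -> 'rV[R]_n -> R) :
  (1 <= n)%N -> 0 < s < 1 ->
  open Omega -> bounded_set Omega -> lipschitz_boundary Omega ->
  (lebesgue n).-integrable (~` Omega) (EFin \o beta) ->
  (\forall x \ae lebesgue n, ~ Omega x -> 0 <= beta x) ->
  form_semigroup Omega (dom_D s Omega) (form_D s Omega) T_D ->
  form_semigroup Omega (dom_R s Omega beta) (form_R s Omega beta) T_R ->
  form_semigroup Omega (dom_N s Omega) (form_N s Omega) T_N ->
  [/\ submarkovian Omega T_D, submarkovian Omega T_R & submarkovian Omega T_N].
Proof.
move=> _ /andP[s0 _] oOmega bOmega _ ibeta beta0 hD hR hN.
have mOmega := measurable_open_rV oOmega.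
have Omega_fin := lebesgue_bounded_lty mOmega bOmega.
split.
- apply: (form_semigroup_submarkovian mOmega _ hD) => c u c0 Du.
  exact: (trunc_dom_D s0 mOmega Omega_fin c0 Du).
- apply: (form_semigroup_submarkovian mOmega _ hR) => c u c0 Du.
  exact: (trunc_dom_R s0 mOmega Omega_fin ibeta beta0 c0 Du).
- apply: (form_semigroup_submarkovian mOmega _ hN) => c u c0 Du.
  exact: (trunc_dom_N s0 mOmega Omega_fin c0 Du).
Qed.
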